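(* Let $n\in\mathbb{N}^+$, $\varepsilon>0$ and $r_\nu=\varepsilon2^{-\nu}$ for $\nu\in\mathbb{N}$. Let $\varphi:[0,\infty)\to[0,\infty)$ be nondecreasing and continuous with $\varphi(0)=0$, and suppose there is $k_*\in\mathbb{N}$ with \[ \int_0^1\frac{\varphi(x)}{x^{k_*+1}}\,\mathrm{d}x<+\infty,\qquad\int_0^1\frac{\varphi(x)}{x^{k_*+2}}\,\mathrm{d}x=+\infty. \] Let $f_\nu$, $\nu\in\mathbb{N}$, be real analytic functions (real on $\mathbb{R}^n$) defined on the strips $\{x\in\mathbb{C}^n:|\operatorname{Im}x|\le r_\nu\}$ with $f_0=0$ and $|f_\nu(x)-f_{\nu-1}(x)|\le\varphi(r_\nu)$ on $|\operatorname{Im}x|\le r_\nu$ for all $\nu\ge1$, and let $f:\mathbb{R}^n\to\mathbb{R}$ be their limit. Then there is a modulus of continuity $\varpi_*$ with $f\in C_{k_*,\varpi_*}(\mathbb{R}^n)$. In particular, $\varpi_*$ can be taken as \[ \varpi_*(\gamma)\sim\gamma\int_{L(\gamma)}^{\varepsilon}\frac{\varphi(t)}{t^{k_*+2}}\,\mathrm{d}t=\mathcal{O}^\#\Big(\int_0^{L(\gamma)}\frac{\varphi(t)}{t^{k_*+1}}\,\mathrm{d}t\Big),\qquad\gamma\to0^+, \] where $L(\gamma)\to0^+$ is some function for which the second relation holds.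
   Context: $|\cdot|$ is the sup-norm. A modulus of continuity is a nondecreasing continuous positive function $\varpi$ on $(0,\delta]$ with $\varpi(0^+)=0$ and $\limsup x/\varpi(x)<\infty$. $[g]_\varpi=\sup_{0<|x-y|\le\delta}|g(x)-g(y)|/\varpi(|x-y|)$, and $C_{k,\varpi}(\mathbb{R}^n)$ is the set of $g$ with partial derivatives up to order $k$ and $\sum_{|\alpha|\le k}(\sup|\partial^\alpha g|+[\partial^\alpha g]_\varpi)<\infty$. For positive functions near $0^+$, $f_1=\mathcal{O}^\#(f_2)$ means $\ell_1f_2\le f_1\le\ell_2f_2$ for constants $0<\ell_1\le\ell_2$; $f_1\sim f_2$ means the same. *)

(* Defs.v *)
From HB Require Import structures.
From mathcomp Require Import all_boot all_order all_algebra.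
From mathcomp Require Import all_classical all_reals all_analysis.
From mathcomp Require Import complex.
Set Implicit Arguments. Unset Strict Implicit. Unset Printing Implicit Defensive.
Import Order.TTheory GRing.Theory Num.Theory.
Import numFieldTopology.Exports numFieldNormedType.Exports.

(* the complex numbers C = R[i], seen as a numeric (closed) field so that
   mathcomp-analysis equips C and C^n with their normed structures *)
Definition CC (R : rcfType) : numClosedFieldType := R[i].
Local Open Scope classical_set_scope.
Local Open Scope ring_scope.

Definition cembed {R : rcfType} {n : nat} (x : 'rV[R]_n) : 'rV[CC R]_n :=
  map_mx (fun t : R => ((t%:C)%C : CC R)) x.

Definition strip {R : rcfType} (n : nat) (r : R) : set 'rV[CC R]_n :=
  [set z | forall j : 'I_n, `|complex.Im (z 0 j : R[i])| <= r].

(* real analytic on the closed strip: holomorphic (complex Frechet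
   differentiable) on some open neighbourhood of the strip *)
Definition analytic_on_strip {R : realType} (n : nat) (r : R)
  (g : 'rV[CC R]_n -> CC R) : Prop :=
  exists U : set 'rV[CC R]_n, open U /\ @strip R n r `<=` U /\
    forall z, U z -> differentiable g z.

Definition unitv {R : realType} {n : nat} (j : 'I_n) : 'rV[R]_n := delta_mx 0 j.

Definition pdiff {R : realType} {n : nat} (s : seq 'I_n) (g : 'rV[R]_n -> R)
  : 'rV[R]_n -> R :=
  foldr (fun j h => fun x => derive h x (unitv j)) g s.

Definition modulus {R : realType} (delta : R) (w : R -> R) : Prop :=
  0 < delta /\
  {in `]0, delta] &, {homo w : x y / x <= y}} /\
  {within `]0, delta], continuous w} /\
  (forall x, 0 < x <= delta -> 0 < w x) /\
  w x @[x --> 0^'+] --> 0 /\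
  (exists C eta : R, 0 < eta /\ forall x, 0 < x < eta -> x / w x <= C).

Definition Ckw {R : realType} {n : nat} (k : nat) (delta : R) (w : R -> R)
  (g : 'rV[R]_n -> R) : Prop :=
  (forall s : seq 'I_n, (size s < k)%N ->
     forall (j : 'I_n) (x : 'rV[R]_n), derivable (pdiff s g) x (unitv j)) /\
  (forall s : seq 'I_n, (size s <= k)%N ->
     (exists M : R, forall x, `|pdiff s g x| <= M) /\
     (exists M : R, forall x y : 'rV[R]_n, 0 < `|x - y| <= delta ->
        `|pdiff s g x - pdiff s g y| <= M * w `|x - y|)).

Definition asym_eq {R : realType} (f1 f2 : R -> R) : Prop :=
  exists l1 l2 eta : R, 0 < l1 /\ l1 <= l2 /\ 0 < eta /\
    forall g, 0 < g < eta -> l1 * f2 g <= f1 g /\ f1 g <= l2 * f2 g.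

(* Main.v *)
Require Import Defs.
From HB Require Import structures.
From mathcomp Require Import all_boot all_order all_algebra.
From mathcomp Require Import all_classical all_reals all_analysis.
From mathcomp Require Import measurable_realfun complex.
From mathcomp Require Import ring lra.
Import Order.TTheory GRing.Theory Num.Theory.
Import numFieldTopology.Exports numFieldNormedType.Exports.
Local Open Scope classical_set_scope.
Local Open Scope ring_scope.

(* Let A(x) be the integral of phi t / t^(k+2) over [x, eps], let B(x) be the integral of
   phi t / t^(k+1) over (0, x], and take w(g) = g A(g) + B(g).  Cauchy's estimates on the strip of
   width r_nu bound the partial derivatives of order m of f_nu - f_(nu-1) by a multiple of
   phi(r_nu) / r_nu^m, so the derivatives of order at most k of the telescoping series converge,
   and an increment of such a derivative over a distance g is at most a multiple of
   sum_nu phi(r_nu) / r_nu^k min(1, g / r_nu).  As phi is monotone and the r_nu are dyadic, this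
   sum is at most a multiple of w(g).  Let L(g) solve g A(L) = B(L).  Since l = g minimizes
   g A(l) + B(l), and since A decreases and B increases, B(L(g)) <= w(g) <= 2 B(L(g)).
   Cauchy's estimates are derived from Goursat's theorem: in the coordinate z = a + e^w it shows
   that circle means do not depend on the radius, so that a value at the centre is bounded by the
   values on a circle; for (g(z) - g(a)) / (z - a) this bounds g'(a).  Applied to difference
   quotients, the bound makes them converge uniformly, and their limit is again holomorphic. *)

(** * Goursat's theorem *)

(** Complex differentiability is given pointwise, with no continuity of the derivative, so Green's
    formula does not apply and Goursat's bisection is the entry point. Afterwards only inequalities
    are needed: bounds at the centre of a disc replace Cauchy's formula and power series, and
    several variables are treated one coordinate line at a time. The factor min(1, g / r_nu) pairs
    the sup bound on a derivative of order k with its Lipschitz bound, which costs one more Cauchy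
    estimate and hence one more power of r_nu. Cutting at r_nu = g turns the two halves into B(g)
    and g A(g). Formally dB = -x dA, so the l-derivative of g A(l) + B(l) is (l - g) |A'(l)|, whence
    the minimum at l = g, and w' = A. The finite integral makes the series converge and B small near
    0; the divergent one makes A unbounded, which gives both the bound on x / w(x) and the existence
    of the balance point. *)

Lemma exists_div_exp2_le {R : realType} (M e : R) :
  0 < e -> exists n : nat, M / 2 ^+ n <= e.
Proof.
move=> e0; have [n Mn] : exists n : nat, M / e < n%:R.
  by exists (Num.bound `|M / e|); apply: (le_lt_trans (ler_norm _)); exact: archi_boundP.
exists n; rewrite ler_pdivrMr ?exprn_gt0//.
have n2 : n%:R <= 2 ^+ n :> R by rewrite -natrX ler_nat ltnW// ltn_expl.
rewrite -ler_pdivrMl// mulrC; apply: le_trans n2; exact: ltW.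
Qed.

Lemma box_quadrisection {R : realType} (J : R -> R -> R -> R -> R) (a b c d x y u v : R) :
  (forall x0 x1 x2 y0 y1, a <= x0 -> x0 <= x1 -> x1 <= x2 -> x2 <= b ->
     c <= y0 -> y0 <= y1 -> y1 <= d ->
     J x0 x2 y0 y1 = J x0 x1 y0 y1 + J x1 x2 y0 y1) ->
  (forall x0 x1 y0 y1 y2, a <= x0 -> x0 <= x1 -> x1 <= b ->
     c <= y0 -> y0 <= y1 -> y1 <= y2 -> y2 <= d ->
     J x0 x1 y0 y2 = J x0 x1 y0 y1 + J x0 x1 y1 y2) ->
  a <= x -> 0 <= u -> x + u + u <= b -> c <= y -> 0 <= v -> y + v + v <= d ->
  J x (x + u + u) y (y + v + v) =
    (J x (x + u) y (y + v) + J x (x + u) (y + v) (y + v + v)) +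
    (J (x + u) (x + u + u) y (y + v) + J (x + u) (x + u + u) (y + v) (y + v + v)).
Proof.
move=> Jx Jy ax u0 xb cy v0 yd.
have x1 : x <= x + u by rewrite lerDl.
have x2 : x + u <= x + u + u by rewrite lerDl.
have y1 : y <= y + v by rewrite lerDl.
have y2 : y + v <= y + v + v by rewrite lerDl.
have y3 : y <= y + v + v := le_trans y1 y2.
rewrite (Jx x (x + u))// (Jy x (x + u) y (y + v))//; last exact: le_trans xb.
by rewrite (Jy (x + u) (x + u + u) y (y + v))//; exact: le_trans ax x1.
Qed.

(* Bisection: a counterexample box has a half-size sub-box with the same density |J| / area. *)
Lemma box_bisection {R : realType} (J : R -> R -> R -> R -> R) (a b c d : R) :
  a < b -> c < d ->
  (forall x0 x1 x2 y0 y1, a <= x0 -> x0 <= x1 -> x1 <= x2 -> x2 <= b ->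
     c <= y0 -> y0 <= y1 -> y1 <= d ->
     J x0 x2 y0 y1 = J x0 x1 y0 y1 + J x1 x2 y0 y1) ->
  (forall x0 x1 y0 y1 y2, a <= x0 -> x0 <= x1 -> x1 <= b ->
     c <= y0 -> y0 <= y1 -> y1 <= y2 -> y2 <= d ->
     J x0 x1 y0 y2 = J x0 x1 y0 y1 + J x0 x1 y1 y2) ->
  (forall p q k, a <= p <= b -> c <= q <= d -> 0 < k ->
     exists2 r, 0 < r & forall x y t, 0 <= t <= r ->
       a <= x -> x <= p -> p <= x + t * (b - a) -> x + t * (b - a) <= b ->
       c <= y -> y <= q -> q <= y + t * (d - c) -> y + t * (d - c) <= d ->
       `|J x (x + t * (b - a)) y (y + t * (d - c))| <= k * t ^+ 2) ->
  J a b c d = 0.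
Proof.
move=> ab cd Jx Jy Jloc; apply: contrapT => J0.
pose k := `|J a b c d| / 2; have k0 : 0 < k.
  by rewrite /k divr_gt0// normr_gt0; apply/eqP.
pose h n : R := (2 ^+ n)^-1.
have h0 n : 0 < h n by rewrite /h invr_gt0 exprn_gt0.
have hS n : h n = h n.+1 + h n.+1.
  by rewrite /h exprS; field; rewrite expf_neq0.
pose in_ n (z : R * R) := [/\ a <= z.1, z.1 + h n * (b - a) <= b,
   c <= z.2 & z.2 + h n * (d - c) <= d].
pose bad n (z : R * R) := in_ n z /\
   k * h n ^+ 2 < `|J z.1 (z.1 + h n * (b - a)) z.2 (z.2 + h n * (d - c))|.
(* The implication sits under the existential so that [choice] yields a total function; for a box
   that is not bad any value will do. *)
have stepP (nz : nat * (R * R)) : exists z' : R * R, bad nz.1 nz.2 -> [/\ bad nz.1.+1 z',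
   nz.2.1 <= z'.1, z'.1 + h nz.1.+1 * (b - a) <= nz.2.1 + h nz.1 * (b - a),
   nz.2.2 <= z'.2 & z'.2 + h nz.1.+1 * (d - c) <= nz.2.2 + h nz.1 * (d - c)].
  case: nz => n [x y] /=; apply: contrapT => /forallNP H.
  have [[[/= ax xb cy yd] Jbig] _] := (not_implyP _ _).1 (H (x, y)).
  have hba : 0 < h n.+1 * (b - a) by rewrite mulr_gt0// subr_gt0.
  have hdc : 0 < h n.+1 * (d - c) by rewrite mulr_gt0// subr_gt0.
  have eba : h n * (b - a) = h n.+1 * (b - a) + h n.+1 * (b - a).
    by rewrite hS mulrDl.
  have edc : h n * (d - c) = h n.+1 * (d - c) + h n.+1 * (d - c).
    by rewrite hS mulrDl.
  rewrite eba addrA in xb Jbig; rewrite edc addrA in yd Jbig.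
  move: Jbig H hba hdc xb yd; rewrite /bad /in_ /= eba edc.
  set u := h n.+1 * (b - a); set v := h n.+1 * (d - c) => Jbig H u0 v0 xb yd.
  have x1 : x <= x + u by rewrite lerDl ltW.
  have x2 : x + u <= x + u + u by rewrite lerDl ltW.
  have y1 : y <= y + v by rewrite lerDl ltW.
  have y2 : y + v <= y + v + v by rewrite lerDl ltW.
  (* If no half-size sub-box is bad, each quarter contributes at most [k * h n.+1 ^+ 2], and the
     four add up to [k * h n ^+ 2], against [Jbig]. *)
  have small x' y' : x <= x' -> x' <= x + u -> y <= y' -> y' <= y + v ->
     `|J x' (x' + u) y' (y' + v)| <= k * h n.+1 ^+ 2.
    move=> xx' x'x yy' y'y; rewrite leNgt; apply/negP => B; apply: (H (x', y')) => _ /=.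
    have x'u : x' + u <= x + u + u by rewrite lerD2r.
    have y'v : y' + v <= y + v + v by rewrite lerD2r.
    split; rewrite ?addrA//; split => //; split.
    - exact: le_trans ax xx'.
    - exact: le_trans x'u xb.
    - exact: le_trans cy yy'.
    - exact: le_trans y'v yd.
  move: Jbig; rewrite (box_quadrisection J a b c d)// ?(ltW u0) ?(ltW v0)//.
  rewrite hS ltNge => /negP; apply.
  apply: (le_trans (ler_normD _ _)).
  apply: (le_trans (lerD (ler_normD _ _) (ler_normD _ _))).
  have -> : k * (h n.+1 + h n.+1) ^+ 2 =
    (k * h n.+1 ^+ 2 + k * h n.+1 ^+ 2) + (k * h n.+1 ^+ 2 + k * h n.+1 ^+ 2) by ring.
  by rewrite !lerD// small.
have [g gP] := choice stepP.
pose s := fix s n : R * R := if n is m.+1 then g (m, s m) else (a, c).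
have sbad n : bad n (s n).
  elim: n => [|n IH]; last by have [] := gP (n, s n) IH.
  rewrite /bad /in_ /= /h expr0 invr1 !mul1r !expr1n mulr1 !subrKC !lexx.
  by split => //; rewrite /k; move: k0; rewrite /k; lra.
have smono m n : (m <= n)%N -> [/\ (s m).1 <= (s n).1,
   (s n).1 + h n * (b - a) <= (s m).1 + h m * (b - a),
   (s m).2 <= (s n).2 &
   (s n).2 + h n * (d - c) <= (s m).2 + h m * (d - c)].
  elim: n => [|n IH]; first by rewrite leqn0 => /eqP ->.
  rewrite leq_eqVlt => /predU1P[<-//|]; rewrite ltnS => /IH[A1 A2 A3 A4].
  have [/= _ B1 B2 B3 B4] := gP (n, s n) (sbad n).
  by split; [exact: le_trans A1 B1|exact: le_trans B2 A2|exact: le_trans A3 B3|exact: le_trans B4 A4].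
have hba n : 0 < h n * (b - a) by rewrite mulr_gt0// subr_gt0.
have hdc n : 0 < h n * (d - c) by rewrite mulr_gt0// subr_gt0.
have sx m n : (s m).1 <= (s n).1 + h n * (b - a).
  have [/smono[A1 A2 _ _]|/ltnW/smono[A1 A2 _ _]] := leqP m n.
    by rewrite (le_trans A1)// lerDl ltW.
  by rewrite (le_trans _ A2)// lerDl ltW.
have sy m n : (s m).2 <= (s n).2 + h n * (d - c).
  have [/smono[_ _ A1 A2]|/ltnW/smono[_ _ A1 A2]] := leqP m n.
    by rewrite (le_trans A1)// lerDl ltW.
  by rewrite (le_trans _ A2)// lerDl ltW.
(* By [sx] and [sy] every lower corner lies below every upper corner, so the suprema give a point
   lying in all the boxes. *)
pose p := sup (range (fun n => (s n).1)); pose q := sup (range (fun n => (s n).2)).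
have supP (f : nat -> R) (l : nat -> R) : (forall m n, f m <= l n) ->
    forall n, f n <= sup (range f) <= l n.
  move=> fl n; apply/andP; split.
    by apply: ub_le_sup; [exists (l 0%N) => _ [m _ <-]|exists n].
  by apply: ge_sup; [exists (f 0%N), 0%N|move=> _ [m _ <-]].
have px := supP _ _ sx; have qy := supP _ _ sy.
have px0 := px 0%N; have qy0 := qy 0%N.
rewrite /= /h expr0 invr1 mul1r subrKC in px0.
rewrite /= /h expr0 invr1 mul1r subrKC in qy0.
have [r r0 Hr] := Jloc p q k px0 qy0 k0.
have [n hn] := exists_div_exp2_le 1 r r0.
have [[I1 I2 I3 I4] Jbig] := sbad n.
have /andP[px1 px2] := px n; have /andP[qy1 qy2] := qy n.
move: Jbig; rewrite ltNge => /negP; apply.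
apply: Hr => //; apply/andP; split; first exact: ltW.
by rewrite /h -div1r.
Qed.

(** For [b < a] the interval is empty and the value is 0, without change of sign; hence the ordering
    hypotheses in the lemmas that follow. *)
Definition int_itv {R : realType} (f : R -> R) (a b : R) : R :=
  Rintegral lebesgue_measure `[a, b] f.

Lemma within_itv_continuous_eps {R : realType} (f : R -> R) (a b : R) :
  (forall x, a <= x <= b -> forall e : R, 0 < e -> exists2 r : R, 0 < r &
     forall y, a <= y <= b -> `|y - x| < r -> `|f y - f x| <= e) ->
  {within `[a, b], continuous f}.
Proof.
move=> H; apply/subspace_continuousP => x; rewrite /= in_itv /= => xab.
apply/cvgrPdist_le => e e0; have [r r0 Hr] := H x xab e e0.
rewrite near_withinE; apply: (filterS _ (@nbhsx_ballx _ R x r r0)) => y xy.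
rewrite /= in_itv /= => yab; rewrite distrC; apply: Hr => //.
by rewrite distrC.
Qed.

Lemma integrable_itv_continuous {R : realType} (f : R -> R) (a b : R) :
  {within `[a, b], continuous f} ->
  lebesgue_measure.-integrable `[a, b] (EFin \o f).
Proof. move=> cf; apply: continuous_compact_integrable => //; exact: segment_compact. Qed.

Lemma int_itv_split {R : realType} (f : R -> R) (a c b : R) : a <= c -> c <= b ->
  {within `[a, b], continuous f} ->
  int_itv f a b = int_itv f a c + int_itv f c b.
Proof.
move=> ac cb cf; have If := integrable_itv_continuous f a b cf.
have := @Rintegral_itvB R f (BLeft a) (BRight b) c If.
rewrite !bnd_simp => /(_ ac cb).
rewrite Rintegral_itv_obnd_cbnd; last first.
  apply: integrableS If => //; apply: subset_itvr.
  by rewrite bnd_simp.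
by move=> E; rewrite /int_itv -E addrC subrK.
Qed.

Lemma int_itv_cst {R : realType} (k a b : R) : a <= b ->
  int_itv (fun=> k) a b = k * (b - a).
Proof.
move=> ab; rewrite /int_itv Rintegral_cst//= lebesgue_measure_itv /= lte_fin.
have [ab'|] := ltP a b; first by rewrite -EFinB.
by move=> ba; have -> : b = a; [by apply/eqP; rewrite eq_le ba ab|rewrite subrr].
Qed.

Lemma int_itv_approx {R : realType} (f : R -> R) (a b k e : R) : a <= b ->
  {within `[a, b], continuous f} ->
  (forall x, a <= x <= b -> `|f x - k| <= e) ->
  `|int_itv f a b - k * (b - a)| <= e * (b - a).
Proof.
move=> ab cf H; have If := integrable_itv_continuous f a b cf.
have cc l : {within `[a, b], continuous (fun=> l : R)}.
  by apply: within_itv_continuous_eps => x _ e' e0; exists 1 => // y _ _; rewrite subrr normr0 ltW.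
have Ic l := integrable_itv_continuous _ _ _ (cc l).
rewrite ler_distl -mulrBl -mulrDl; apply/andP; split.
  rewrite -int_itv_cst//; apply: le_Rintegral => // x; rewrite /= in_itv /= => /H.
  by rewrite ler_distl => /andP[].
rewrite -int_itv_cst//; apply: le_Rintegral => // x; rewrite /= in_itv /= => /H.
by rewrite ler_distl => /andP[].
Qed.

Lemma int_itvB {R : realType} (f g : R -> R) (a b : R) :
  {within `[a, b], continuous f} -> {within `[a, b], continuous g} ->
  int_itv (fun x => f x - g x) a b = int_itv f a b - int_itv g a b.
Proof.
by move=> cf cg; rewrite /int_itv RintegralB//; exact: integrable_itv_continuous.
Qed.

(** Total differentiability at one point, with partial derivatives [a] and [b]; nothing is asked of
    neighbouring points. *)
Definition diff2 {R : numDomainType} (F : R -> R -> R) (x0 y0 a b : R) : Prop :=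
  forall e : R, 0 < e -> exists2 r : R, 0 < r & forall x y,
    `|x - x0| <= r -> `|y - y0| <= r ->
    `|F x y - F x0 y0 - a * (x - x0) - b * (y - y0)| <= e * (`|x - x0| + `|y - y0|).

Lemma diff2_continuous {R : realType} (F : R -> R -> R) (x0 y0 a b : R) :
  diff2 F x0 y0 a b -> forall e : R, 0 < e -> exists2 r : R, 0 < r & forall x y,
    `|x - x0| <= r -> `|y - y0| <= r -> `|F x y - F x0 y0| <= e.
Proof.
move=> DF e e0; have [r r0 Hr] := DF 1 ltr01.
pose k := `|a| + `|b| + 2; have k0 : 0 < k.
  by rewrite /k ltr_wpDl// addr_ge0.
exists (Num.min r (e / k)); first by rewrite lt_min r0 divr_gt0.
move=> x y; rewrite !le_min => /andP[xr xe] /andP[yr ye].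
have := Hr x y xr yr; rewrite mul1r; set f := F x y - F x0 y0 => H.
have -> : f = (f - a * (x - x0) - b * (y - y0)) + a * (x - x0) + b * (y - y0) by ring.
apply: (le_trans (ler_normD _ _)); apply: (le_trans (lerD (ler_normD _ _) (lexx _))).
rewrite !normrM; apply: (le_trans (lerD (lerD H (lexx _)) (lexx _))).
have -> : `|x - x0| + `|y - y0| + `|a| * `|x - x0| + `|b| * `|y - y0| =
  (`|a| + 1) * `|x - x0| + (`|b| + 1) * `|y - y0| by ring.
have -> : e = (`|a| + 1) * (e / k) + (`|b| + 1) * (e / k).
  by rewrite /k; field; rewrite -/k gt_eqF.
by apply: lerD; apply: ler_wpM2l => //; rewrite addr_ge0.
Qed.

Lemma diff2_continuous1 {R : realType} (F : R -> R -> R) (a b y : R) :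
  (forall x, a <= x <= b -> exists p q, diff2 F x y p q) ->
  {within `[a, b], continuous (fun x => F x y)}.
Proof.
move=> H; apply: within_itv_continuous_eps => x /H[p [q D]] e e0.
have [r r0 Hr] := diff2_continuous _ _ _ _ _ D e e0.
by exists r => // x' _ xx'; apply: Hr; rewrite ?subrr ?normr0 ltW.
Qed.

Lemma diff2_continuous2 {R : realType} (F : R -> R -> R) (a b x : R) :
  (forall y, a <= y <= b -> exists p q, diff2 F x y p q) ->
  {within `[a, b], continuous (F x)}.
Proof.
move=> H; apply: within_itv_continuous_eps => y /H[p [q D]] e e0.
have [r r0 Hr] := diff2_continuous _ _ _ _ _ D e e0.
by exists r => // y' _ yy'; apply: Hr; rewrite ?subrr ?normr0 ltW.
Qed.

Lemma within_continuousB {R : realType} (f g : R -> R) (A : set R) :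
  {within A, continuous f} -> {within A, continuous g} ->
  {within A, continuous (fun x => f x - g x)}.
Proof. by move=> cf cg x; apply: cvgB; [exact: cf|exact: cg]. Qed.

(** Both end points are expanded at ([p], [q]), the only point where differentiability is known;
    subtracting the two expansions gives the factor 2. *)
Lemma diff2_increment {R : realType} (F : R -> R -> R) (p q a b e r x x' y y' s : R) :
  0 <= e ->
  (forall x y, `|x - p| <= r -> `|y - q| <= r ->
    `|F x y - F p q - a * (x - p) - b * (y - q)| <= e * (`|x - p| + `|y - q|)) ->
  `|x - p| + `|y - q| <= s -> `|x' - p| + `|y' - q| <= s -> s <= r ->
  `|F x' y' - F x y - (a * (x' - x) + b * (y' - y))| <= 2 * e * s.
Proof.
move=> e0 H h1 h2 sr.
have nl (u v : R) : `|u| <= `|u| + `|v| by rewrite lerDl.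
have nr (u v : R) : `|v| <= `|u| + `|v| by rewrite lerDr.
have near_ u v : `|u - p| + `|v - q| <= s ->
    `|F u v - F p q - a * (u - p) - b * (v - q)| <= e * s.
  move=> h; have hr := le_trans h sr.
  apply: (le_trans (H u v (le_trans (nl _ _) hr) (le_trans (nr _ _) hr))).
  exact: ler_wpM2l.
have H1 := near_ _ _ h1; have H2 := near_ _ _ h2.
have -> : F x' y' - F x y - (a * (x' - x) + b * (y' - y)) =
  (F x' y' - F p q - a * (x' - p) - b * (y' - q)) -
  (F x y - F p q - a * (x - p) - b * (y - q)) by ring.
apply: (le_trans (ler_normB _ _)); apply: (le_trans (lerD H2 H1)).
by rewrite -mulrDr -mulr2n -mulrA mulrCA mulr_natl.
Qed.

Lemma dist_in_itv {R : realType} (x l u p : R) :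
  x <= u <= x + l -> x <= p <= x + l -> `|u - p| <= l.
Proof. by move=> /andP[? ?] /andP[? ?]; rewrite ler_norml; apply/andP; split; lra. Qed.

(* Goursat's theorem for the differential form P dx + Q dy, closed in the sense dP/dy = dQ/dx. *)
Lemma goursat_rectangle {R : realType} (P Q : R -> R -> R) (a b c d : R) :
  a < b -> c < d ->
  (forall x y, a <= x <= b -> c <= y <= d ->
     exists p m q, diff2 P x y p m /\ diff2 Q x y m q) ->
  int_itv (Q b) c d - int_itv (Q a) c d =
  int_itv (P^~ d) a b - int_itv (P^~ c) a b.
Proof.
move=> ab cd H.
have cP x0 x1 y : a <= x0 -> x1 <= b -> c <= y <= d ->
    {within `[x0, x1], continuous (P^~ y)}.
  move=> ax bx cyd; apply: diff2_continuous1 => x /andP[h1 h2].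
  have [|p [m [q [DP _]]]] := H x y _ cyd; last by exists p, m.
  by rewrite (le_trans ax h1) (le_trans h2 bx).
have cQ y0 y1 x : c <= y0 -> y1 <= d -> a <= x <= b ->
    {within `[y0, y1], continuous (Q x)}.
  move=> ax bx cyd; apply: diff2_continuous2 => y /andP[h1 h2].
  have [|p [m [q [_ DQ]]]] := H x y cyd; last by exists m, q.
  by rewrite (le_trans ax h1) (le_trans h2 bx).
pose J x0 x1 y0 y1 := (int_itv (Q x1) y0 y1 - int_itv (Q x0) y0 y1) -
   (int_itv (P^~ y1) x0 x1 - int_itv (P^~ y0) x0 x1).
apply/eqP; rewrite -subr_eq0; apply/eqP; apply: (box_bisection J) => //.
- move=> x0 x1 x2 y0 y1 h1 h2 h3 h4 h5 h6 h7; rewrite /J.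
  rewrite (int_itv_split (P^~ y0) x0 x1 x2)// ?(int_itv_split (P^~ y1) x0 x1 x2)//; first ring.
    by apply: cP => //; rewrite h7 (le_trans h5 h6).
  by apply: cP => //; rewrite h5 (le_trans h6 h7).
- move=> x0 x1 y0 y1 y2 h1 h2 h3 h4 h5 h6 h7; rewrite /J.
  rewrite (int_itv_split (Q x0) y0 y1 y2)// ?(int_itv_split (Q x1) y0 y1 y2)//; first ring.
    by apply: cQ => //; rewrite h3 (le_trans h1 h2).
  by apply: cQ => //; rewrite h1 (le_trans h2 h3).
move=> p q k pab qcd k0; have [p1 [m [q2 [DP DQ]]]] := H p q pab qcd.
pose X := b - a; pose Y := d - c.
have X0 : 0 < X by rewrite subr_gt0.
have Y0 : 0 < Y by rewrite subr_gt0.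
have XY0 : 0 < X + Y by rewrite addr_gt0.
(* Each of the two error terms below is [2 * e * (t * (X + Y))] times a side length, [t * X] or
   [t * Y]; together they equal [k * t ^+ 2]. *)
pose e := k / (2 * (X + Y) ^+ 2).
have e0 : 0 < e by rewrite divr_gt0// mulr_gt0// exprn_gt0.
have [r1 r10 HP] := DP e e0; have [r2 r20 HQ] := DQ e e0.
exists (Num.min r1 r2 / (X + Y)); first by rewrite divr_gt0// lt_min r10.
move=> x y t /andP[t0]; rewrite ler_pdivlMr// le_min => /andP[tr1 tr2].
rewrite -/X -/Y => ax xp px xb cy yq qy yd.
have tX : 0 <= t * X by rewrite mulr_ge0// ltW.
have tY : 0 <= t * Y by rewrite mulr_ge0// ltW.
have xX : x <= x + t * X by rewrite lerDl.
have yY : y <= y + t * Y by rewrite lerDl.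
have dist u v : x <= u <= x + t * X -> y <= v <= y + t * Y ->
    `|u - p| + `|v - q| <= t * (X + Y).
  move=> ux vy; rewrite mulrDr; apply: lerD.
    by apply: (dist_in_itv x) => //; rewrite xp px.
  by apply: (dist_in_itv y) => //; rewrite yq qy.
have yYd : c <= y + t * Y <= d by rewrite (le_trans cy yY).
have yd' : c <= y <= d by rewrite cy (le_trans yY).
have xXb : a <= x + t * X <= b by rewrite (le_trans ax xX).
have xb' : a <= x <= b by rewrite ax (le_trans xX).
have EP : `|int_itv (fun u => P u (y + t * Y) - P u y) x (x + t * X) -
    m * (t * Y) * (x + t * X - x)| <= 2 * e * (t * (X + Y)) * (x + t * X - x).
  apply: int_itv_approx => //.
    by apply: within_continuousB; apply: cP.
  move=> u ux.
  have := diff2_increment P p q p1 m e r1 u u y (y + t * Y) (t * (X + Y)) (ltW e0) HP.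
  rewrite subrr mulr0 add0r [y + _ - y]addrAC subrr add0r; apply => //; apply: dist => //.
    by rewrite lexx yY.
  by rewrite lexx yY.
have EQ : `|int_itv (fun v => Q (x + t * X) v - Q x v) y (y + t * Y) -
    m * (t * X) * (y + t * Y - y)| <= 2 * e * (t * (X + Y)) * (y + t * Y - y).
  apply: int_itv_approx => //.
    by apply: within_continuousB; apply: cQ.
  move=> v vy.
  have := diff2_increment Q p q m q2 e r2 x (x + t * X) v v (t * (X + Y)) (ltW e0) HQ.
  rewrite subrr mulr0 addr0 [x + _ - x]addrAC subrr add0r; apply => //; apply: dist => //.
    by rewrite lexx xX.
  by rewrite lexx xX.
move: EP EQ; rewrite int_itvB ?int_itvB; try exact: cP; try exact: cQ.
rewrite ![_ + _ * _ - _]addrAC !subrr !add0r => EP EQ.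
rewrite /J; set j1 := int_itv (Q _) _ _ - int_itv (Q _) _ _ in EQ *.
set j2 := int_itv _ _ _ - int_itv _ _ _ in EP *.
(* The linear parts of the two increments are the same number, since the coefficient [m] is shared;
   only the errors survive. *)
have -> : j1 - j2 = (j1 - m * (t * X) * (t * Y)) - (j2 - m * (t * Y) * (t * X)) by ring.
apply: (le_trans (ler_normB _ _)); apply: (le_trans (lerD EQ EP)).
rewrite le_eqVlt; apply/orP; left; apply/eqP.
by rewrite /e; field; rewrite gt_eqF.
Qed.

(** * Complex differentiability and Cauchy's estimates *)

(** The norm on [R[i]] takes values in [R[i]] itself; its real part lets the estimates take place in
    the ordered field [R]. *)
Definition cabs {R : rcfType} (z : R[i]) : R := complex.Re `|z|.

Definition rc {R : rcfType} (x : R) : R[i] := x%:C%C.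

Section cabs_theory.
Context {R : rcfType}.
Implicit Types (z w : R[i]) (x y : R).

Lemma cabsE z : `|z| = rc (cabs z).
Proof. by rewrite /cabs normc_def. Qed.

Lemma rcD x y : rc (x + y) = rc x + rc y. Proof. exact: rmorphD. Qed.
Lemma rcM x y : rc (x * y) = rc x * rc y. Proof. exact: rmorphM. Qed.
Lemma rcB x y : rc (x - y) = rc x - rc y. Proof. exact: rmorphB. Qed.
Lemma rc_inj : injective (@rc R). Proof. exact: complexI. Qed.
Lemma rc_le x y : (rc x <= rc y) = (x <= y). Proof. exact: lecR. Qed.
Lemma rc_lt x y : (rc x < rc y) = (x < y). Proof. exact: ltcR. Qed.

Lemma cabs_ge0 z : 0 <= cabs z.
Proof. by rewrite -(ler0c (cabs z)) -[(_)%:C%C]/(rc _) -cabsE. Qed.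

Lemma cabs_le z x : (cabs z <= x) = (`|z| <= rc x).
Proof. by rewrite cabsE rc_le. Qed.

Lemma cabsD z w : cabs (z + w) <= cabs z + cabs w.
Proof. by rewrite cabs_le rcD -!cabsE ler_normD. Qed.

Lemma cabsM z w : cabs (z * w) = cabs z * cabs w.
Proof. by apply: rc_inj; rewrite rcM -!cabsE normrM. Qed.

Lemma cabsN z : cabs (- z) = cabs z.
Proof. by rewrite /cabs normrN. Qed.

Lemma cabsB z w : cabs (z - w) <= cabs z + cabs w.
Proof. by rewrite (le_trans (cabsD _ _))// cabsN. Qed.

Lemma cabs_distC z w : cabs (z - w) = cabs (w - z).
Proof. by rewrite -cabsN opprB. Qed.

Lemma cabs0 : cabs (0 : R[i]) = 0.
Proof. by rewrite /cabs normr0. Qed.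

Lemma cabs1 : cabs (1 : R[i]) = 1.
Proof. by rewrite /cabs normr1. Qed.

Lemma cabs_real x : cabs (rc x) = `|x|.
Proof. by rewrite /cabs normc_def /= expr0n addr0 sqrtr_sqr. Qed.

Lemma cabs_eq0 z : (cabs z == 0) = (z == 0).
Proof. by rewrite -[RHS]normr_eq0 cabsE -(inj_eq rc_inj). Qed.

Lemma cabs_gt0 z : (0 < cabs z) = (z != 0).
Proof. by rewrite lt_neqAle cabs_ge0 andbT eq_sym cabs_eq0. Qed.

Lemma cabsV z : cabs z^-1 = (cabs z)^-1.
Proof.
have [->|z0] := eqVneq z 0; first by rewrite invr0 cabs0 invr0.
apply: (@mulfI _ (cabs z)); first by rewrite cabs_eq0.
by rewrite -cabsM !mulfV ?cabs_eq0// cabs1.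
Qed.

Lemma cabs_div z w : cabs (z / w) = cabs z / cabs w.
Proof. by rewrite cabsM cabsV. Qed.

Lemma Re_le_cabs z : `|complex.Re z| <= cabs z.
Proof. by rewrite -rc_le -cabsE; exact: normc_ge_Re. Qed.

Lemma Im_le_cabs z : `|complex.Im z| <= cabs z.
Proof.
have -> : cabs z = cabs (z * 'i%C).
  rewrite cabsM [X in _ * X](_ : _ = 1) ?mulr1//.
  by rewrite /cabs normc_def /= expr0n expr1n add0r sqrtr1.
by rewrite -normrN -ReiNIm Re_le_cabs.
Qed.

Lemma cabs_le_Re_Im z : cabs z <= `|complex.Re z| + `|complex.Im z|.
Proof.
rewrite [z in cabs z]complexE (le_trans (cabsD _ _))// cabsM.
rewrite -[(complex.Re z)%:C%C]/(rc _) -[(complex.Im z)%:C%C]/(rc _) !cabs_real.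
rewrite [X in X * _](_ : _ = 1) ?mul1r//.
by rewrite /cabs normc_def /= expr0n expr1n add0r sqrtr1.
Qed.

Lemma cabs_triangle z1 z2 z3 : cabs (z1 - z3) <= cabs (z1 - z2) + cabs (z2 - z3).
Proof. by rewrite -[z1 - z3](subrKA z2) cabsD. Qed.

End cabs_theory.

(** The quotient is cleared, so [h = 0] needs no exception, and the bounds range over [R] rather
    than over positive elements of [R[i]]. *)
Definition cdiff {R : rcfType} (g : R[i] -> R[i]) (z d : R[i]) : Prop :=
  forall e : R, 0 < e -> exists2 r : R, 0 < r & forall h, cabs h <= r ->
    cabs (g (z + h) - g z - d * h) <= e * cabs h.

Section cdiff_theory.
Context {R : rcfType}.
Implicit Types (g f : R[i] -> R[i]) (z w d a : R[i]).

Lemma cdiff_cst w z : cdiff (fun=> w) z 0.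
Proof.
move=> e e0; exists 1 => // h _; rewrite subrr mul0r subr0 cabs0.
by apply: mulr_ge0; [exact: ltW|exact: cabs_ge0].
Qed.

Lemma cdiffM w g z d : cdiff g z d -> cdiff (fun x => w * g x) z (w * d).
Proof.
move=> D e e0; have k0 : 0 < cabs w + 1 by rewrite ltr_wpDl// cabs_ge0.
have [r r0 H] := D (e / (cabs w + 1)) (divr_gt0 e0 k0).
exists r => // h hr; rewrite -mulrBr -mulrA -mulrBr cabsM.
apply: (le_trans (ler_wpM2l (cabs_ge0 _) (H h hr))).
rewrite mulrA ler_wpM2r ?cabs_ge0// mulrCA ler_piMr ?(ltW e0)//.
by rewrite ler_pdivrMr// mul1r lerDl.
Qed.

Lemma cdiffB g f z d d' : cdiff g z d -> cdiff f z d' ->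
  cdiff (fun x => g x - f x) z (d - d').
Proof.
move=> Dg Df e e0; have e20 : 0 < e / 2 by rewrite divr_gt0.
have [r r0 H] := Dg _ e20; have [s s0 K] := Df _ e20.
exists (Num.min r s); first by rewrite lt_min r0.
move=> h; rewrite le_min => /andP[hr hs].
have -> : g (z + h) - f (z + h) - (g z - f z) - (d - d') * h =
  (g (z + h) - g z - d * h) - (f (z + h) - f z - d' * h) by ring.
rewrite (le_trans (cabsB _ _))// (le_trans (lerD (H _ hr) (K _ hs)))//.
by rewrite -mulrDl -splitr.
Qed.

Lemma cdiff_lipschitz g z d : cdiff g z d -> exists2 r : R, 0 < r &
  forall h, cabs h <= r -> cabs (g (z + h) - g z) <= (cabs d + 1) * cabs h.
Proof.
move=> D; have [r r0 H] := D 1 ltr01; exists r => // h hr.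
have -> : g (z + h) - g z = (g (z + h) - g z - d * h) + d * h by ring.
rewrite (le_trans (cabsD _ _))// (le_trans (lerD (H _ hr) (lexx _)))//.
by rewrite cabsM -mulrDl addrC.
Qed.

Lemma cdiff_comp g f z d d' : cdiff f z d -> cdiff g (f z) d' ->
  cdiff (g \o f) z (d' * d).
Proof.
move=> Df Dg e e0.
pose k := cabs d' + cabs d + 1.
have k0 : 0 < k by rewrite ltr_wpDl// addr_ge0// cabs_ge0.
have e1 : 0 < e / (2 * k) by rewrite divr_gt0// mulr_gt0.
have [r r0 H] := cdiff_lipschitz _ _ _ Df.
have [s s0 K] := Df _ e1; have [t t0 L] := Dg _ e1.
exists (Num.min (Num.min r s) (t / k)).
  by rewrite !lt_min r0 s0 divr_gt0.
move=> h; rewrite !le_min ler_pdivlMr// => /andP[/andP[hr hs] ht].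
pose u := f (z + h) - f z; have uh : cabs u <= k * cabs h.
  apply: le_trans (H _ hr) _; rewrite ler_wpM2r ?cabs_ge0//.
  by rewrite lerD2r lerDr cabs_ge0.
have := L u; rewrite {1 2}/u subrKC => /(_ (le_trans uh _)).
rewrite mulrC ht => /(_ isT) Lu.
have -> : (g \o f) (z + h) - (g \o f) z - d' * d * h =
  (g (f (z + h)) - g (f z) - d' * u) + d' * (f (z + h) - f z - d * h).
  by rewrite /= /u; ring.
rewrite (le_trans (cabsD _ _))// cabsM.
apply: (le_trans (lerD Lu (ler_wpM2l (cabs_ge0 _) (K _ hs)))).
apply: (@le_trans _ _ (e / (2 * k) * (k * cabs h) + k * (e / (2 * k) * cabs h))).
  apply: lerD; first by apply: ler_wpM2l => //; exact: ltW.
  apply: ler_wpM2r; first by rewrite mulr_ge0 ?cabs_ge0// ltW.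
  by rewrite /k -addrA lerDl addr_ge0// cabs_ge0.
rewrite le_eqVlt; apply/orP; left; apply/eqP; field.
by rewrite gt_eqF.
Qed.

Lemma cdiff_slope g a z d : z != a -> cdiff g z d ->
  cdiff (fun x => (g x - g a) / (x - a)) z ((d - (g z - g a) / (z - a)) / (z - a)).
Proof.
rewrite -subr_eq0 => za D e e0.
set v := z - a in za *; set G := g z - g a; pose N := cabs v.
have N0 : 0 < N by rewrite cabs_gt0.
pose M := cabs (d * v - G) + 1.
have M0 : 0 < M by rewrite ltr_wpDl// cabs_ge0.
have [r r0 H] := D (e * N / 4) ltac:(by rewrite divr_gt0// mulr_gt0).
(* The bound [N / 2] keeps [v + h] away from 0; the other two give each of the two remainder terms
   below the share [e / 2]. *)
exists (Num.min r (Num.min (N / 2) (e * N ^+ 3 / (4 * M)))).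
  by rewrite !lt_min r0 !divr_gt0// ?mulr_gt0// exprn_gt0.
move=> h; rewrite !le_min => /andP[hr /andP[hN hM]].
have vh : N / 2 <= cabs (v + h).
  have : N <= cabs (v + h) + cabs h by rewrite /N -{1}(addrK h v) cabsB.
  by move: hN; lra.
have vh0 : v + h != 0 by rewrite -cabs_gt0 (lt_le_trans _ vh)// divr_gt0.
have -> : z + h - a = v + h by rewrite /v addrAC.
have -> : (g (z + h) - g a) / (v + h) - G / v - (d - G / v) / v * h =
   (g (z + h) - g z - d * h) / (v + h) - h * h * (d * v - G) / (v * v * (v + h)).
  by rewrite /G; field; rewrite za vh0.
rewrite (le_trans (cabsB _ _))// !cabs_div !cabsM -/N.
have vhV : (cabs (v + h))^-1 <= 2 / N.
  by rewrite -[2 / N]invf_div lef_pV2// posrE ?divr_gt0// cabs_gt0.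
have E1 : cabs (g (z + h) - g z - d * h) / cabs (v + h) <= e / 2 * cabs h.
  apply: (@le_trans _ _ (e * N / 4 * cabs h * (2 / N))).
    by apply: ler_pM => //; rewrite ?cabs_ge0 ?invr_ge0 ?cabs_ge0//; exact: H.
  by rewrite le_eqVlt; apply/orP; left; apply/eqP; field; rewrite gt_eqF.
have E2 : cabs h * cabs h * cabs (d * v - G) / (N * N * cabs (v + h)) <= e / 2 * cabs h.
  apply: (@le_trans _ _ (cabs h * (e * N ^+ 3 / (4 * M)) * M * ((N * N)^-1 * (2 / N)))).
    rewrite invfM.
    have h0 := cabs_ge0 h; have m0 := cabs_ge0 (d * v - G).
    have i0 : 0 <= (cabs (v + h))^-1 by rewrite invr_ge0 cabs_ge0.
    have n0 : 0 <= (N * N)^-1 by rewrite invr_ge0 mulr_ge0// ltW.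
    apply: ler_pM => //; rewrite ?mulr_ge0//.
      apply: ler_pM => //; rewrite ?mulr_ge0//; first exact: ler_wpM2l.
      by rewrite /M lerDl.
    exact: ler_wpM2l.
  by rewrite le_eqVlt; apply/orP; left; apply/eqP; field; rewrite !gt_eqF.
by rewrite (le_trans (lerD E1 E2))// -mulrDl -splitr.
Qed.

(** Cauchy-Riemann: multiplication by [d] is the real matrix with rows (Re d, -Im d) and (Im d, Re
    d). The repeated entry Re d is the shared coefficient that Goursat's theorem asks for. *)
Lemma cdiff_diff2 g (x y : R) d : cdiff g (x +i* y)%C d ->
  diff2 (fun s t => complex.Re (g (s +i* t)%C)) x y (complex.Re d) (- complex.Im d) /\
  diff2 (fun s t => complex.Im (g (s +i* t)%C)) x y (complex.Im d) (complex.Re d).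
Proof.
move=> D; have K e : 0 < e -> exists2 r, 0 < r & forall s t,
    `|s - x| <= r -> `|t - y| <= r ->
    cabs (g (s +i* t)%C - g (x +i* y)%C - d * ((s - x) +i* (t - y))%C)
      <= e * (`|s - x| + `|t - y|).
  move=> e0; have [r r0 H] := D e e0; exists (r / 2); first exact: divr_gt0.
  move=> s t sx ty; pose h := ((s - x) +i* (t - y))%C.
  have hst : cabs h <= `|s - x| + `|t - y| := cabs_le_Re_Im h.
  have := H h; rewrite (_ : _ + h = (s +i* t)%C); last first.
    by rewrite /h; simpc; rewrite !subrKC.
  rewrite (le_trans hst) => [/(_ isT)|]; last by move: sx ty; lra.
  by move=> /le_trans; apply; apply: ler_wpM2l => //; exact: ltW.
split=> e /K[r r0 H]; exists r => // s t sx ty; apply: le_trans (H s t sx ty).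
  apply: le_trans (Re_le_cabs _); rewrite le_eqVlt; apply/orP; left; apply/eqP.
  case: d {D K H} => d1 d2; case: (g _) => a1 a2; case: (g _) => b1 b2; simpc => /=.
  by congr `|_|; ring.
apply: le_trans (Im_le_cabs _); rewrite le_eqVlt; apply/orP; left; apply/eqP.
case: d {D K H} => d1 d2; case: (g _) => a1 a2; case: (g _) => b1 b2; simpc => /=.
by congr `|_|; ring.
Qed.

End cdiff_theory.

(** Stated over any numeric field, so that it serves both for real derivatives and for the complex
    derivatives in the analyticity hypothesis. *)
Lemma is_derive_eps {R : numFieldType} {V : normedModType R} (f : V -> R) (x v : V) (df : R) :
  is_derive x v f df <-> forall e : R, 0 < e -> exists2 r : R, 0 < r & forall h : R,
    `|h| <= r -> `|f (x + h *: v) - f x - df * h| <= e * `|h|.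
Proof.
have key h c : h != 0 -> (`|c - h^-1 *: (f (h *: v + x) - f x)| =
    `|f (x + h *: v) - f x - c * h| / `|h|).
  move=> h0; rewrite -normfV -normrM distrC addrC /GRing.scale /=.
  by congr `|_|; rewrite [h *: v + x]addrC; field.
split=> [[df1 df2] e e0|H].
  have : h^-1 *: ((f \o shift x) (h *: v) - f x) @[h --> 0^'] --> df.
    by rewrite -df2; exact: df1.
  move=> /cvgrPdist_le/(_ e e0)/nbhs_ballP[r /= r0 Hr].
  exists (r / 2); first exact: divr_gt0.
  move=> h hr; have [->|h0] := eqVneq h 0.
    by rewrite scale0r addr0 subrr mulr0 subr0 normr0 mulr0.
  have := Hr h; rewrite /ball /= sub0r normrN /= key// => /(_ _ h0).
  rewrite ler_pdivrMr ?normr_gt0//; apply; apply: le_lt_trans hr _.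
  by rewrite ltr_pdivrMr// ltr_pMr// ltr1n.
have cv : h^-1 *: ((f \o shift x) (h *: v) - f x) @[h --> 0^'] --> df.
  apply/cvgrPdist_le => e e0; have [r r0 Hr] := H e e0.
  apply/nbhs_ballP; exists r => //= h; rewrite /ball /= sub0r normrN => hr h0.
  by rewrite key// ler_pdivrMr ?normr_gt0//; apply: Hr; exact: ltW.
by split; [apply/cvg_ex; exists df|exact: cvg_lim cv].
Qed.

(** * The complex exponential *)

Section cexp.
Context {R : realType}.
Implicit Types (z w h : R[i]).

Definition cexp z : R[i] :=
  (expR (complex.Re z) * cos (complex.Im z) +i* (expR (complex.Re z) * sin (complex.Im z)))%C.

Lemma cexpD z w : cexp (z + w) = cexp z * cexp w.
Proof.
case: z w => [a b] [c d]; rewrite /cexp /= expRD cosD sinD; simpc.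
by congr (_ +i* _)%C; ring.
Qed.

Lemma cabs_cexp z : cabs (cexp z) = expR (complex.Re z).
Proof.
by rewrite /cabs normc_def /= !exprMn -mulrDr cos2Dsin2 mulr1 sqrtr_sqr ger0_norm ?ltW ?expR_gt0.
Qed.

Lemma cexp_is_cdiff0 : cdiff cexp 0 1.
Proof.
(* Four error terms with constants 3, 1, 3 and 2 add up to 9 times [a]; the bound [a <= 1] is what
   keeps [expR x] below 3. *)
move=> e e0; pose a := Num.min (e / 9) 1.
have a0 : 0 < a by rewrite lt_min ltr01 andbT divr_gt0.
have ae : a <= e / 9 by rewrite /a ge_min lexx.
have a1 : a <= 1 by rewrite /a ge_min lexx orbT.
have [r r0 Hr] := (is_derive_eps expR 0 1 _).1 (is_derive_expR 0) a a0.
have [s s0 Hs] := (is_derive_eps sin 0 1 _).1 (is_derive_sin 0) a a0.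
have [t t0 Ht] := (is_derive_eps cos 0 1 _).1 (is_derive_cos 0) a a0.
exists (Num.min (Num.min r s) (Num.min t (a / 2))).
  by rewrite !lt_min r0 s0 t0 divr_gt0.
case=> x y; rewrite !le_min => /andP[/andP[hr hs] /andP[ht ha]].
have xh : `|x| <= cabs (x +i* y)%C := Re_le_cabs (x +i* y)%C.
have yh : `|y| <= cabs (x +i* y)%C := Im_le_cabs (x +i* y)%C.
have := Hr x (le_trans xh hr); have := Hs y (le_trans yh hs); have := Ht y (le_trans yh ht).
rewrite !add0r !sin0 !cos0 !expR0 oppr0 !mul1r mul0r !subr0 addr0 !scaler1 => C S E.
have nxh := le_trans xh ha; have nyh := le_trans yh ha.
have x0 := normr_ge0 x; have y0 := normr_ge0 y.
have E1 : `|expR x - 1| <= 2 * a.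
  have : `|expR x - 1| <= a * `|x| + `|x|.
    by rewrite -{1}(subrK x (expR x - 1)) (le_trans (ler_normD _ _))// lerD2r.
  by move/le_trans; apply; nra.
have E2 : `|expR x| <= 3.
  rewrite -{1}(subrK 1 (expR x)) (le_trans (ler_normD _ _))// normr1.
  by rewrite (le_trans (lerD E1 (lexx _)))//; lra.
have -> : cexp (x +i* y)%C - cexp 0 - (x +i* y)%C =
   ((expR x * (cos y - 1) + (expR x - 1 - x)) +i*
    (expR x * (sin y - y) + (expR x - 1) * y))%C.
  by rewrite /cexp /= expR0 cos0 sin0; simpc; congr (_ +i* _)%C; ring.
apply: le_trans (cabs_le_Re_Im _) _.
move: xh yh; set n := cabs _ => xh yh /=.
apply: le_trans (lerD (ler_normD _ _) (ler_normD _ _)) _; rewrite !normrM.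
have P1 : `|expR x| * `|cos y - 1| <= 3 * (a * n).
  by apply: ler_pM => //; apply: le_trans C _; rewrite ler_wpM2l// ltW.
have P2 : `|expR x - 1 - x| <= a * n.
  by apply: le_trans E _; rewrite ler_wpM2l// ltW.
have P3 : `|expR x| * `|sin y - y| <= 3 * (a * n).
  by apply: ler_pM => //; apply: le_trans S _; rewrite ler_wpM2l// ltW.
have P4 : `|expR x - 1| * `|y| <= 2 * a * n by apply: ler_pM.
apply: le_trans (lerD (lerD P1 P2) (lerD P3 P4)) _.
rewrite (_ : _ + _ = 9 * a * n); last by ring.
rewrite ler_wpM2r//; first exact: cabs_ge0.
by rewrite mulrC -ler_pdivlMr.
Qed.

Lemma cexp_is_cdiff z : cdiff cexp z (cexp z).
Proof.
move=> e e0; have c0 : 0 < cabs (cexp z) by rewrite cabs_cexp expR_gt0.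
have [r r0 H] := cexp_is_cdiff0 (e / cabs (cexp z)) (divr_gt0 e0 c0).
exists r => // h hr; have := H h hr; rewrite add0r mul1r cexpD.
have -> : cexp 0 = 1 by rewrite /cexp /= expR0 cos0 sin0 mulr1 mulr0.
move=> E; have -> : cexp z * cexp h - cexp z - cexp z * h =
  cexp z * (cexp h - 1 - h) by ring.
by rewrite cabsM -ler_pdivlMl// mulrA [_^-1 * e]mulrC.
Qed.

Lemma cexp_periodic (s : R) : cexp (s +i* (pi *+ 2))%C = cexp (s +i* 0)%C.
Proof. by rewrite /cexp /= cos2pi sin2pi cos0 sin0. Qed.

Lemma cabs_polar (a w : R[i]) : cabs (a + cexp w - a) = expR (complex.Re w).
Proof. by rewrite [a + _ - a]addrAC subrr add0r cabs_cexp. Qed.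

End cexp.

(** * Circle means and Cauchy's bound for the first derivative *)

Lemma le_of_mean {R : realFieldType} (I1 I2 c K e L : R) : 0 < L -> I1 = I2 ->
  `|I1 - 0 * (L - 0)| <= K * (L - 0) -> `|I2 - c * (L - 0)| <= e * (L - 0) -> c <= K + e.
Proof.
move=> L0 <-; rewrite mul0r !subr0 => H1; rewrite ler_distl => /andP[H2 _].
have := le_trans H2 (le_trans (ler_norm _) H1).
by rewrite lerBlDr -mulrDl ler_pM2r.
Qed.

(* The circle means of g around a do not depend on the radius: in the coordinate z = a + e^w this
   is Goursat's theorem on a rectangle of height 2 pi, whose horizontal sides cancel. *)
Lemma Re_center_le_circle {R : realType} (g : R[i] -> R[i]) (a : R[i]) (r K : R) :
  0 < r ->
  (forall z, 0 < cabs (z - a) <= r -> exists d, cdiff g z d) ->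
  (forall e : R, 0 < e -> exists2 s : R, 0 < s & forall z, cabs (z - a) <= s -> cabs (g z - g a) <= e) ->
  (forall z, cabs (z - a) = r -> cabs (g z) <= K) ->
  complex.Re (g a) <= K.
Proof.
move=> r0 Dg ga gK; apply/ler_addgt0Pr => e e0.
have [s s0 Hs] := ga e e0.
pose G w := g (a + cexp w).
have DG w : complex.Re w <= ln r -> exists d, cdiff G w d.
  move=> wr; have [|d Dd] := Dg (a + cexp w).
    by rewrite cabs_polar expR_gt0 -(lnK (x := r)) ?posrE// ler_expR.
  exists (d * cexp w); apply: (cdiff_comp g (fun w => a + cexp w)) => //.
  have := cdiffB _ _ _ _ _ (cexp_is_cdiff w) (cdiff_cst (- a) w).
  by rewrite subr0; under [fun x => _]eq_fun do rewrite opprK addrC.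
(* The left side must lie strictly left of [s1] and map into the disc where [g] is within [e] of
   [g a]. *)
pose s1 := ln r; pose s0' := Num.min (ln s) (s1 - 1).
have s01 : s0' < s1 by rewrite /s0' gt_min orbC ltrBlDr ltrDl ltr01.
have pi2 : 0 < pi *+ 2 :> R by rewrite mulrn_wgt0// pi_gt0.
(* With [P] the imaginary and [Q] the real part, dP/dy = dQ/dx is one of the Cauchy-Riemann
   equations. *)
pose P x y := complex.Im (G (x +i* y)%C); pose Q x y := complex.Re (G (x +i* y)%C).
have PQ x y : s0' <= x <= s1 -> 0 <= y <= pi *+ 2 ->
    exists p m q, diff2 P x y p m /\ diff2 Q x y m q.
  move=> /andP[_ xs] _; have [d /cdiff_diff2[D1 D2]] := DG (x +i* y)%C xs.
  by exists (complex.Im d), (complex.Re d), (- complex.Im d).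
have := goursat_rectangle P Q s0' s1 0 (pi *+ 2) s01 pi2 PQ.
have -> : P^~ (pi *+ 2) = P^~ 0.
  by apply: funext => x; rewrite /P /G cexp_periodic.
move=> E; have QQ := subr0_eq (etrans E (subrr _)) => {E}.
have cQ x : s0' <= x <= s1 -> {within `[0, pi *+ 2], continuous (Q x)}.
  move=> xs; apply: diff2_continuous2 => y /(PQ x y xs)[p [m [q [_ D]]]].
  by exists m, q.
have I1 : `|int_itv (Q s1) 0 (pi *+ 2) - 0 * (pi *+ 2 - 0)| <= K * (pi *+ 2 - 0).
  apply: int_itv_approx; [exact: ltW|by apply: cQ; rewrite lexx ltW|].
  move=> y _; rewrite subr0; apply: (le_trans (Re_le_cabs _)); apply: gK.
  by rewrite cabs_polar; exact: lnK.
have I2 : `|int_itv (Q s0') 0 (pi *+ 2) - complex.Re (g a) * (pi *+ 2 - 0)| <= e * (pi *+ 2 - 0).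
  apply: int_itv_approx; [exact: ltW|by apply: cQ; rewrite lexx ltW|].
  move=> y _; rewrite /Q (_ : _ - _ = complex.Re (G (s0' +i* y)%C - g a)); last first.
    by case: (G _) => ? ?; case: (g a) => ? ?.
  apply: le_trans (Re_le_cabs _) _; apply: Hs.
  rewrite cabs_polar -(lnK (x := s)) ?posrE// ler_expR /=.
  by rewrite /s0' ge_min lexx.
exact: le_of_mean pi2 QQ I1 I2.
Qed.

(** Multiplying by a unimodular [w] makes the central value real and positive, which reduces the
    claim to the real part. *)
Lemma cabs_center_le_circle {R : realType} (g : R[i] -> R[i]) (a : R[i]) (r K : R) :
  0 < r ->
  (forall z, 0 < cabs (z - a) <= r -> exists d, cdiff g z d) ->
  (forall e : R, 0 < e -> exists2 s : R, 0 < s & forall z, cabs (z - a) <= s -> cabs (g z - g a) <= e) ->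
  (forall z, cabs (z - a) = r -> cabs (g z) <= K) ->
  cabs (g a) <= K.
Proof.
move=> r0 Dg ga gK.
have [ga0|ga0] := eqVneq (g a) 0.
  (* Here only [0 <= K] is at stake, and any point of the circle provides it. *)
  rewrite ga0 cabs0; apply: le_trans (gK (a + rc r) _); first exact: cabs_ge0.
  by rewrite addrC addKr cabs_real gtr0_norm.
pose w := rc (cabs (g a)) / g a.
have w1 : cabs w = 1.
  by rewrite /w cabs_div cabs_real ger0_norm ?cabs_ge0// mulfV// cabs_eq0.
have -> : cabs (g a) = complex.Re (w * g a) by rewrite /w divfK.
apply: (Re_center_le_circle (fun z => w * g z) a r) => //.
- by move=> z /Dg[d Dd]; exists (w * d); exact: cdiffM.
- move=> e /ga[s s0 H]; exists s => // z /H; by rewrite -mulrBr cabsM w1 mul1r.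
- by move=> z /gK; rewrite cabsM w1 mul1r.
Qed.

(** The slope, completed by [d] at [a], is continuous at [a] but not yet known to be differentiable
    there; this is why the centre bound asks for differentiability only off the centre. The 2 comes
    from estimating [g z - g a]. *)
Lemma cauchy_derivative_bound {R : realType} (g : R[i] -> R[i]) (a d : R[i]) (r M : R) :
  0 < r -> cdiff g a d ->
  (forall z, cabs (z - a) <= r -> exists d, cdiff g z d) ->
  (forall z, cabs (z - a) <= r -> cabs (g z) <= M) ->
  cabs d <= 2 * M / r.
Proof.
move=> r0 Da Dg gM.
pose q z := if z == a then d else (g z - g a) / (z - a).
have qE z : z != a -> q z = (g z - g a) / (z - a) by rewrite /q => /negbTE ->.
have -> : d = q a by rewrite /q eqxx.
apply: (cabs_center_le_circle q a r) => //.
- move=> z /andP[za zr]; have [d' D'] := Dg z zr.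
  rewrite cabs_gt0 subr_eq0 in za.
  exists ((d' - (g z - g a) / (z - a)) / (z - a)) => e e0.
  have [s s0 H] := cdiff_slope _ _ _ _ za D' e e0.
  exists (Num.min s (cabs (z - a) / 2)).
    by rewrite lt_min s0 divr_gt0// cabs_gt0 subr_eq0.
  move=> h; rewrite le_min => /andP[hs hz]; rewrite !qE//; first exact: H.
  apply/eqP => E; have ez : z - a = - h by rewrite -E opprD addNKr.
  move: hz; rewrite ez cabsN => hz.
  have h0 : 0 < cabs h by rewrite -cabsN -ez cabs_gt0 subr_eq0.
  by move: hz h0; lra.
- move=> e e0; have [s s0 H] := Da e e0; exists s => // z zs.
  have [->|za] := eqVneq z a; first by rewrite subrr cabs0 ltW.
  have h0 : z - a != 0 by rewrite subr_eq0.
  have := H (z - a) zs; rewrite subrKC qE// /q eqxx => E.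
  rewrite (_ : _ - d = (g z - g a - d * (z - a)) / (z - a)); last by field.
  by rewrite cabs_div ler_pdivrMr// cabs_gt0.
- move=> z zr; have za : z != a by rewrite -subr_eq0 -cabs_gt0 zr.
  have ga : cabs (g a) <= M by apply: gM; rewrite subrr cabs0 ltW.
  have gz : cabs (g z) <= M by apply: gM; rewrite zr.
  rewrite (qE z za) cabs_div zr; apply: ler_wpM2r; first by rewrite invr_ge0 ltW.
  by rewrite (le_trans (cabsB _ _))// mulrDl !mul1r lerD.
Qed.

Lemma mean_value_bound {R : realType} (F : R -> R) (K a b : R) : a <= b ->
  (forall t, a <= t <= b -> exists2 d, `|d| <= K & is_derive t 1 F d) ->
  `|F b - F a| <= K * (b - a).
Proof.
move=> ab H.
have DF t : a <= t <= b -> is_derive t 1 F ('D_1 F t).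
  by move=> /H[d _ [Dd _]]; exact: derivableP.
have DF' t : t \in `]a, b[%R -> is_derive t 1 F ('D_1 F t).
  by rewrite in_itv /= => /andP[ta tb]; apply: DF; rewrite !ltW.
have cF : {within `[a, b], continuous F}.
  apply: derivable_within_continuous => t; rewrite in_itv /= => tab.
  by have [] := DF t tab.
have [c] := MVT_segment ab DF' cF.
rewrite in_itv /= => /H[d dK [_ dE]] ->; rewrite dE normrM.
by rewrite [`|b - a|]ger0_norm ?subr_ge0// ler_wpM2r// subr_ge0.
Qed.

(** * One complex variable: mean values, expansions, uniform limits *)

Section one_variable.
Context {R : realType}.
Implicit Types (G : R[i] -> R[i]) (a b v d h t z : R[i]).

Lemma cdiff_affine a v t : cdiff (fun s => a + s * v) t v.
Proof.
move=> e e0; exists 1 => // h _.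
rewrite (_ : _ - _ - _ = 0); last by ring.
by rewrite cabs0 mulr_ge0 ?cabs_ge0// ltW.
Qed.

Lemma cdiff_Re_derive G (x : R) d : cdiff G (rc x) d ->
  is_derive x (1 : R) (fun y : R => complex.Re (G (rc y))) (complex.Re d).
Proof.
move=> D; apply/is_derive_eps => e e0; have [r r0 H] := D e e0.
exists r => // h hr; have := H (rc h); rewrite cabs_real => /(_ hr).
apply: le_trans; apply: le_trans (Re_le_cabs _).
rewrite scaler1 rcD; case: (G _) => a1 a2; case: (G _) => b1 b2.
by case: d {D H} => d1 d2 /=; rewrite mulr0 subr0.
Qed.

(** Equality in the mean value theorem fails for complex values; a rotation [w] makes the total
    increment real, and the real theorem applies to the real part along the segment. *)
Lemma cdiff_mean_value G a b (K : R) :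
  (forall t : R, 0 <= t <= 1 ->
     exists2 d, cabs d <= K & cdiff G (a + rc t * (b - a)) d) ->
  cabs (G b - G a) <= K * cabs (b - a).
Proof.
move=> H; have K0 : 0 <= K.
  by have [|d dK _] := H 0; rewrite ?lexx ?ler01// (le_trans (cabs_ge0 d)).
have [->|ne] := eqVneq (G b - G a) 0; first by rewrite cabs0 mulr_ge0 ?cabs_ge0.
have [w w1 wE] : exists2 w, cabs w = 1 & w * (G b - G a) = rc (cabs (G b - G a)).
  exists (rc (cabs (G b - G a)) / (G b - G a)); last by rewrite divfK.
  by rewrite cabs_div cabs_real ger0_norm ?cabs_ge0// mulfV// cabs_eq0.
pose T s := w * G (a + s * (b - a)); pose F (t : R) := complex.Re (T (rc t)).
have T0 : T 0 = w * G a by rewrite /T mul0r addr0.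
have T1 : T 1 = w * G b by rewrite /T mul1r subrKC.
have -> : cabs (G b - G a) = F 1 - F 0.
  have -> : F 1 - F 0 = complex.Re (T 1 - T 0).
    by rewrite /F /rc /=; case: (T 1) => ? ?; case: (T 0) => ? ?.
  by rewrite T0 T1 -mulrBr wE.
apply: (le_trans (ler_norm _)).
rewrite -[K * _]mulr1 -[X in _ <= _ * X](subr0 1); apply: mean_value_bound; first exact: ler01.
move=> t /H[d dK Dd]; exists (complex.Re (w * (d * (b - a)))).
  by rewrite (le_trans (Re_le_cabs _))// !cabsM w1 mul1r ler_wpM2r// cabs_ge0.
apply: cdiff_Re_derive; apply: cdiffM.
exact: cdiff_comp (cdiff_affine a (b - a) (rc t)) Dd.
Qed.

Lemma cdiff_shift G a t d : cdiff G (a + t) d -> cdiff (fun s => G (a + s)) t d.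
Proof.
by move=> D e /D[r r0 H]; exists r => // h /H; rewrite addrA.
Qed.

Definition hol_disc (r : R) G := forall z, cabs z <= r -> exists d, cdiff G z d.

(* The difference [z |-> G (z + h) - G z] is bounded by a multiple of |h|; applying Cauchy's
   bound to it shows that G' is Lipschitz, although it is not yet known to be differentiable. *)
Lemma cdiff_taylor1 G (r M : R) h d : 0 < r ->
  hol_disc (3 * r) G -> (forall z, cabs z <= 3 * r -> cabs (G z) <= M) ->
  cdiff G 0 d -> cabs h <= r ->
  cabs (G h - G 0 - d * h) <= 4 * M / r ^+ 2 * cabs h ^+ 2.
Proof.
move=> r0 HG GM D0 hr.
have seg a b s (t : R) : 0 <= t <= 1 -> cabs a <= s -> cabs b <= s ->
    cabs (a + rc t * (b - a)) <= s.
  move=> /andP[t0 t1] sa sb.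
  have -> : a + rc t * (b - a) = rc (1 - t) * a + rc t * b by rewrite rcB; ring.
  rewrite (le_trans (cabsD _ _))// !cabsM !cabs_real !ger0_norm ?subr_ge0//.
  have -> : s = (1 - t) * s + t * s by ring.
  by rewrite lerD// ler_wpM2l// subr_ge0.
(* Radius budget: a point and a shift of size [r] reach [2 * r], and Cauchy's bound there uses one
   more [r], whence the hypothesis on [3 * r]. *)
have B1 z d' : cabs z <= 2 * r -> cdiff G z d' -> cabs d' <= 2 * M / r.
  move=> zr Dd'; apply: (cauchy_derivative_bound G z) => // y yz.
    apply: HG; rewrite -(subrK z y) (le_trans (cabsD _ _))//.
    by rewrite (le_trans (lerD yz zr))//; lra.
  apply: GM; rewrite -(subrK z y) (le_trans (cabsD _ _))//.
  by rewrite (le_trans (lerD yz zr))//; lra.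
have L z z' : cabs z <= 2 * r -> cabs z' <= 2 * r ->
    cabs (G z' - G z) <= 2 * M / r * cabs (z' - z).
  move=> zr zr'; apply: cdiff_mean_value => t /seg ts.
  have tr := ts _ _ _ zr zr'.
  have [|d' Dd'] := HG (z + rc t * (z' - z)); first by rewrite (le_trans tr)//; lra.
  by exists d' => //; exact: B1 tr Dd'.
have B2 k d' : cabs k <= r -> cdiff G k d' -> cabs (d' - d) <= 4 * M / r ^+ 2 * cabs k.
  move=> kr Dk.
  have -> : 4 * M / r ^+ 2 * cabs k = 2 * (2 * M / r * cabs k) / r.
    by field; rewrite gt_eqF.
  have tri y : cabs y <= r -> cabs (k + y) <= 2 * r.
    by move=> yr; rewrite (le_trans (cabsD _ _))// (le_trans (lerD kr yr))//; lra.
  apply: (cauchy_derivative_bound (fun z => G (k + z) - G z) 0) => //.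
  - by apply: cdiffB => //; apply: cdiff_shift; rewrite addr0.
  - move=> y; rewrite subr0 => yr.
    have [|d1 D1] := HG (k + y); first by rewrite (le_trans (tri y yr))//; lra.
    have [|d2 D2] := HG y; first by rewrite (le_trans yr)//; lra.
    by exists (d1 - d2); apply: cdiffB => //; exact: cdiff_shift.
  - move=> y; rewrite subr0 => yr; rewrite -{2}(addrK y k).
    by apply: L; [rewrite (le_trans yr)//; lra|exact: tri].
pose T z := G z - d * z.
have -> : G h - G 0 - d * h = T h - T 0 by rewrite /T; ring.
rewrite expr2 mulrA -[X in _ <= _ * cabs X](subr0 h); apply: cdiff_mean_value => t t01.
rewrite subr0 add0r.
have th : cabs (rc t * h) <= cabs h.
  have /andP[t0 t1] := t01.
  by rewrite cabsM cabs_real ger0_norm// ler_piMl// cabs_ge0.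
have [|d' Dd'] := HG (rc t * h).
  by rewrite (le_trans th)// (le_trans hr)//; lra.
exists (d' - d).
  apply: (le_trans (B2 _ _ (le_trans th hr) Dd')); apply: ler_wpM2l => //.
  rewrite divr_ge0 ?exprn_ge0 ?(ltW r0)// mulr_ge0//.
  by rewrite (le_trans (cabs_ge0 (G 0)))// GM// cabs0 mulr_ge0// ltW.
apply: cdiffB => //; have := cdiff_affine 0 d (rc t * h).
by under [X in cdiff X]eq_fun do rewrite add0r mulrC.
Qed.

(** Approximants are indexed by their accuracy [e] rather than by integers; the limit is the
    supremum of the lower bounds [u e - K * e]. *)
Lemma Cauchy_family_limit (u : R -> R) (K : R) :
  (forall e e' : R, 0 < e -> 0 < e' -> `|u e - u e'| <= K * (e + e')) ->
  exists l, forall e, 0 < e -> `|u e - l| <= K * e.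
Proof.
move=> H; pose S := [set u e - K * e | e in [set e : R | 0 < e]].
have ubS e : 0 < e -> ubound S (u e + K * e).
  move=> e0 _ [e' /= e'0 <-]; have := H e' e e'0 e0.
  by move=> /(le_trans (ler_norm _)); rewrite lerBlDr lerBlDr mulrDr => h; lra.
have nS : S !=set0 by exists (u 1 - K * 1), 1 => //=; exact: ltr01.
exists (sup S) => e e0; rewrite ler_distl; apply/andP; split.
  rewrite lerBlDr; have : sup S <= u e + K * e by apply: ge_sup => //; exact: ubS.
  have : u e - K * e <= sup S.
    by apply: ub_le_sup; [exists (u 1 + K * 1); apply: ubS|exists e].
  by lra.
have : u e - K * e <= sup S.
  by apply: ub_le_sup; [exists (u 1 + K * 1); apply: ubS|exists e].
by rewrite lerBlDr.
Qed.

(** Weierstrass' theorem at the centre of a disc: by Cauchy's bound, uniformly close approximants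
    have close derivatives, and the limit of these is the derivative of [G]. *)
Lemma cdiff_uniform_limit G (r : R) : 0 < r ->
  (forall e : R, 0 < e -> exists2 H, hol_disc (2 * r) H &
     forall z, cabs z <= 2 * r -> cabs (H z - G z) <= e) ->
  exists d, cdiff G 0 d.
Proof.
move=> r0 HG.
have /choice[E EP] : forall e : R, exists H, 0 < e ->
     hol_disc (2 * r) H /\ forall z, cabs z <= 2 * r -> cabs (H z - G z) <= e.
  move=> e; case: (ltP 0 e) => [e0|_]; last by exists G.
  by have [H H1 H2] := HG e e0; exists H.
pose D e e' z := E e z - E e' z.
have r20 : 0 <= 2 * r by rewrite mulr_ge0// ltW.
have DM e e' z : 0 < e -> 0 < e' -> cabs z <= 2 * r -> cabs (D e e' z) <= e + e'.
  move=> e0 e'0 zr; rewrite (le_trans (cabs_triangle _ (G z) _))//.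
  apply: lerD; first exact: (EP e e0).2.
  by rewrite cabs_distC; exact: (EP e' e'0).2.
have D1 e e' z d : 0 < e -> 0 < e' -> cabs z <= r -> cdiff (D e e') z d ->
    cabs d <= 2 / r * (e + e').
  move=> e0 e'0 zr Dd; rewrite mulrAC; apply: (cauchy_derivative_bound (D e e') z) => // y yz.
    have yr : cabs y <= 2 * r.
      by rewrite -(subrK z y) (le_trans (cabsD _ _))// mulrDl !mul1r lerD.
    have [d1 H1] := (EP e e0).1 y yr; have [d2 H2] := (EP e' e'0).1 y yr.
    by exists (d1 - d2); exact: cdiffB.
  apply: DM => //.
  by rewrite -(subrK z y) (le_trans (cabsD _ _))// mulrDl !mul1r lerD.
have /choice[dE dEP] : forall e : R, exists d, 0 < e -> cdiff (E e) 0 d.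
  move=> e; case: (ltP 0 e) => [e0|_]; last by exists 0.
  by have [|d Dd] := (EP e e0).1 0; [rewrite cabs0|exists d].
have dEC e e' : 0 < e -> 0 < e' -> cabs (dE e - dE e') <= 2 / r * (e + e').
  move=> e0 e'0; apply: (D1 e e' 0) => //; first by rewrite cabs0 ltW.
  by apply: cdiffB; exact: dEP.
have [x xP] : exists x, forall e, 0 < e -> `|complex.Re (dE e) - x| <= 2 / r * e.
  apply: (Cauchy_family_limit (fun e => complex.Re (dE e))) => e e' e0 e'0.
  apply: le_trans (dEC e e' e0 e'0); apply: le_trans (Re_le_cabs _).
  by case: (dE e) => ? ?; case: (dE e') => ? ?.
have [y yP] : exists y, forall e, 0 < e -> `|complex.Im (dE e) - y| <= 2 / r * e.
  apply: (Cauchy_family_limit (fun e => complex.Im (dE e))) => e e' e0 e'0.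
  apply: le_trans (dEC e e' e0 e'0); apply: le_trans (Im_le_cabs _).
  by case: (dE e) => ? ?; case: (dE e') => ? ?.
(* Three errors, [4 / r * k], [r^-1 * k] and [4 / r * k], add up to [9 / r * k], which is [e]. *)
exists (x +i* y)%C => e e0; pose k := e / (9 / r).
have rV : 0 < r^-1 by rewrite invr_gt0.
have k0 : 0 < k by rewrite divr_gt0// divr_gt0.
have dk : cabs (dE k - (x +i* y)%C) <= 4 / r * k.
  apply: (le_trans (cabs_le_Re_Im _)).
  have := lerD (xP k k0) (yP k k0); rewrite -mulrDl -mulrDl -natrD.
  by case: (dE k) => ? ?.
have [s s0 Hs] := dEP k k0 (r^-1 * k) (mulr_gt0 rV k0).
exists (Num.min s r); first by rewrite lt_min s0.
move=> h; rewrite le_min add0r => /andP[hs hr].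
(* No derivative of [G] is available yet, so [G] is replaced by an approximant [E p] with [p <= k];
   the mean value bound applies to [D p k], and the cost [q] is arbitrary. *)
have Gk : cabs ((G h - G 0) - (E k h - E k 0)) <= 4 / r * k * cabs h.
  apply/ler_addgt0Pr => q q0.
  pose p := Num.min k (q / 2).
  have p0 : 0 < p by rewrite lt_min k0 divr_gt0.
  have h2 : cabs h <= 2 * r by rewrite (le_trans hr)// ler_pMl// ler1n.
  have z2 : cabs (0 : R[i]) <= 2 * r by rewrite cabs0.
  have Dpk : cabs (D p k h - D p k 0) <= 4 / r * k * cabs h.
    rewrite -[X in _ * cabs X](subr0 h); apply: cdiff_mean_value => t /andP[t0 t1].
    rewrite subr0 add0r.
    have th : cabs (rc t * h) <= r.
      rewrite cabsM cabs_real ger0_norm// (le_trans _ hr)//.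
      by rewrite ler_piMl// cabs_ge0.
    have th2 : cabs (rc t * h) <= 2 * r by rewrite (le_trans th)// ler_pMl// ler1n.
    have [d1 H1] := (EP p p0).1 _ th2; have [d2 H2] := (EP k k0).1 _ th2.
    exists (d1 - d2); last exact: cdiffB.
    apply: le_trans (D1 p k _ _ p0 k0 th (cdiffB _ _ _ _ _ H1 H2)) _.
    have -> : 4 / r * k = 2 / r * (k + k) by ring.
    apply: ler_wpM2l; first by rewrite mulr_ge0// ltW.
    by rewrite lerD2r /p ge_min lexx.
  have -> : G h - G 0 - (E k h - E k 0) =
     (D p k h - D p k 0) - ((E p h - G h) - (E p 0 - G 0)) by rewrite /D; ring.
  rewrite (le_trans (cabsB _ _))// lerD// (le_trans (cabsB _ _))//.
  have -> : q = q / 2 + q / 2 by rewrite -splitr.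
  have pq : p <= q / 2 by rewrite /p ge_min lexx orbT.
  by rewrite lerD// (le_trans _ pq)//; apply: (EP p p0).2.
have := Hs h hs; rewrite add0r => Ek.
have -> : G h - G 0 - (x +i* y)%C * h =
  ((G h - G 0) - (E k h - E k 0)) + (E k h - E k 0 - dE k * h)
   + (dE k - (x +i* y)%C) * h by ring.
apply: (le_trans (cabsD _ _)); rewrite cabsM.
apply: (le_trans (lerD (cabsD _ _) (lexx _))).
apply: (le_trans (lerD (lerD Gk Ek) (ler_wpM2r (cabs_ge0 h) dk))).
rewrite -!mulrDl ler_wpM2r ?cabs_ge0//.
rewrite le_eqVlt; apply/orP; left; apply/eqP; rewrite /k; field.
by rewrite gt_eqF.
Qed.

End one_variable.

(** * Separately holomorphic functions on strips *)

Section several_variables.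
Context {R : realType} {n : nat}.
Implicit Types (g : 'rV[R[i]]_n -> R[i]) (z : 'rV[R[i]]_n) (i j : 'I_n).

Definition ostrip (r : R) z := forall j, `|complex.Im (z 0 j)| < r.

Definition pcdiff g j z (d : R[i]) := cdiff (fun t => g (z + t *: delta_mx 0 j)) 0 d.

Definition sep_hol (r : R) g := forall z, ostrip r z -> forall j, exists d, pcdiff g j z d.

(** The derivative is selected by [xget], with default 0 where none exists; [pdP] recovers it on
    strips of separate holomorphy. *)
Definition pd j g z : R[i] := xget 0 [set d | pcdiff g j z d].

Definition pds (s : seq 'I_n) g := foldr pd g s.

Lemma ostrip_shift (r s : R) z j (t : R[i]) :
  ostrip r z -> cabs t <= s -> ostrip (r + s) (z + t *: delta_mx 0 j).
Proof.
move=> zr ts i; rewrite !mxE eqxx /=.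
have -> : complex.Im (z 0 i + t * (i == j)%:R) =
    complex.Im (z 0 i) + complex.Im (t * (i == j)%:R).
  by case: (z 0 i) => ? ?; case: (t * _).
rewrite (le_lt_trans (ler_normD _ _))// ltr_leD//.
rewrite (le_trans (Im_le_cabs _))// (le_trans _ ts)// cabsM.
by case: eqP => _; rewrite ?cabs1 ?cabs0 ?mulr1 ?mulr0 ?cabs_ge0.
Qed.

Lemma ostrip_le (r s : R) z : r <= s -> ostrip r z -> ostrip s z.
Proof. by move=> rs zr j; exact: lt_le_trans (zr j) rs. Qed.

Lemma pcdiff_line g j z (t d : R[i]) : pcdiff g j (z + t *: delta_mx 0 j) d ->
  cdiff (fun s => g (z + s *: delta_mx 0 j)) t d.
Proof.
move=> D e /D[r r0 H]; exists r => // h /H.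
by rewrite add0r scale0r addr0 scalerDl (addrA z).
Qed.

Lemma pcdiff_translate g j z (v : 'rV[R[i]]_n) d : pcdiff g j (z + v) d ->
  pcdiff (fun w => g (w + v)) j z d.
Proof.
move=> D e /D[r r0 H]; exists r => // h /H.
by rewrite ![z + _ + v]addrAC.
Qed.

Lemma sep_hol_line (r s q : R) g j z : sep_hol r g -> ostrip s z -> s + q <= r ->
  hol_disc q (fun t => g (z + t *: delta_mx 0 j)).
Proof.
move=> Hg zs sqr t tq.
have [|d Dd] := Hg (z + t *: delta_mx 0 j) _ j.
  exact: ostrip_le sqr (ostrip_shift _ _ _ _ _ zs tq).
by exists d; exact: pcdiff_line.
Qed.

Lemma pdP (r : R) g j z : sep_hol r g -> ostrip r z -> pcdiff g j z (pd j g z).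
Proof. by move=> Hg zr; have [d Dd] := Hg z zr j; exact: (xgetPex 0 (ex_intro _ d Dd)). Qed.

Lemma pd_bound (r q M : R) g j z : 0 < q -> sep_hol r g ->
  (forall w, ostrip r w -> cabs (g w) <= M) ->
  ostrip (r - q) z -> cabs (pd j g z) <= 2 * M / q.
Proof.
move=> q0 Hg gM zr.
have rqr : r - q + q <= r by rewrite subrK.
apply: (cauchy_derivative_bound (fun t => g (z + t *: delta_mx 0 j)) 0) => //.
- apply: (pdP r) => //; apply: ostrip_le zr; by rewrite gerBl ltW.
- by move=> t; rewrite subr0 => tq; apply: (sep_hol_line r (r - q) q) => //.
- move=> t; rewrite subr0 => tq; apply: gM.
  exact: ostrip_le rqr (ostrip_shift _ _ _ _ _ zr tq).
Qed.

(* The difference quotients of g in direction j converge uniformly to the partial derivative. *)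
Lemma sep_hol_pd (r q M : R) g j : 0 < q -> sep_hol r g ->
  (forall w, ostrip r w -> cabs (g w) <= M) ->
  sep_hol (r - 5 * q) (pd j g).
Proof.
move=> q0 Hg gM z zr i; apply: (cdiff_uniform_limit _ (q / 2)); first exact: divr_gt0.
have q2 : 2 * (q / 2) = q by rewrite mulrC divfK.
have M0 : 0 <= M.
  apply: le_trans (gM z _); first exact: cabs_ge0.
  by apply: ostrip_le zr; rewrite gerBl mulr_ge0// ltW.
(* The expansion error of the difference quotient, [4 * M / q ^+ 2 * h], must be at most [e]; the
   [+ 1] avoids division by zero. *)
rewrite q2 => e e0; pose h := Num.min q (e * q ^+ 2 / (4 * M + 1)).
have M1 : 0 < 4 * M + 1 by rewrite ltr_wpDl// mulr_ge0.
have h0 : 0 < h by rewrite lt_min q0 divr_gt0// mulr_gt0// exprn_gt0.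
have hq : h <= q by rewrite /h ge_min lexx.
have he : h <= e * q ^+ 2 / (4 * M + 1) by rewrite /h ge_min lexx orbT.
have hc0 : rc h != 0 by rewrite -cabs_gt0 cabs_real gtr0_norm.
have hcq : cabs (rc h) <= q by rewrite cabs_real gtr0_norm.
(* Of the loss [5 * q], one [q] pays for moving in direction [i], and [3 * q] for the disc in
   direction [j] on which the expansion is made. *)
have zi t : cabs t <= q -> ostrip (r - 4 * q) (z + t *: delta_mx 0 i).
  move=> tq; have := ostrip_shift _ _ _ i _ zr tq.
  by rewrite (_ : r - 5 * q + q = r - 4 * q)//; ring.
exists (fun t => (rc h)^-1 * (g (z + t *: delta_mx 0 i + rc h *: delta_mx 0 j) -
                              g (z + t *: delta_mx 0 i))).
  move=> t tq; have zt := zi t tq.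
  have zth := ostrip_shift _ _ _ j _ zt hcq.
  have zth' : ostrip r (z + t *: delta_mx 0 i + rc h *: delta_mx 0 j).
    apply: ostrip_le zth; rewrite (_ : _ + q = r - 3 * q); last by ring.
    by rewrite gerBl mulr_ge0// ltW.
  have zt' : ostrip r (z + t *: delta_mx 0 i).
    by apply: ostrip_le zt; rewrite gerBl mulr_ge0// ltW.
  have [d1 D1] := Hg _ zth' i; have [d2 D2] := Hg _ zt' i.
  exists ((rc h)^-1 * (d1 - d2)); apply: cdiffM; apply: cdiffB.
    exact: pcdiff_line (pcdiff_translate _ _ _ _ _ D1).
  exact: pcdiff_line D2.
move=> t tq; have zt := zi t tq.
have zr' : ostrip r (z + t *: delta_mx 0 i).
  by apply: ostrip_le zt; rewrite gerBl mulr_ge0// ltW.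
have r3 : r - 4 * q + 3 * q <= r by rewrite -addrA gerDl; lra.
have := @cdiff_taylor1 R (fun s => g (z + t *: delta_mx 0 i + s *: delta_mx 0 j)) q M (rc h)
  (pd j g (z + t *: delta_mx 0 i)) q0.
rewrite scale0r addr0 => /(_ (sep_hol_line _ _ _ _ j _ Hg zt r3)) T.
have {}T := T (fun s sq => gM _ (ostrip_le _ _ _ r3 (ostrip_shift _ _ _ _ _ zt sq)))
  (pdP _ _ j _ Hg zr') hcq.
set A := g _ in T *; set B := g _ in T *; set P := pd _ _ _ in T *.
have -> : (rc h)^-1 * (A - B) - P = (rc h)^-1 * (A - B - P * rc h) by field.
rewrite cabsM cabsV cabs_real gtr0_norm// ler_pdivrMl//.
apply: le_trans T _.
rewrite cabs_real gtr0_norm// expr2 mulrA mulrC ler_pM2l//.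
rewrite mulrAC ler_pdivrMr ?mulr_gt0//.
move: he; rewrite ler_pdivlMr// => he; apply: le_trans he.
by rewrite mulrC ler_wpM2l// ?lerDl ?ler01// ltW.
Qed.

Lemma sep_holB (r : R) f g : sep_hol r f -> sep_hol r g -> sep_hol r (fun z => f z - g z).
Proof.
move=> Hf Hg z zr j; have [d1 D1] := Hf z zr j; have [d2 D2] := Hg z zr j.
by exists (d1 - d2); apply: cdiffB.
Qed.

(** Each derivative halves the strip: with [q] a tenth of the current width, [sep_hol_pd] loses
    [5 * q]. *)
Lemma cauchy_iterated_partials (m : nat) : exists2 C : R, 0 <= C &
  forall (r M : R) g (s : seq 'I_n), 0 < r -> 0 <= M -> size s = m -> sep_hol r g ->
  (forall w, ostrip r w -> cabs (g w) <= M) ->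
  sep_hol (r / 2 ^+ m) (pds s g) /\
  forall w, ostrip (r / 2 ^+ m) w -> cabs (pds s g w) <= C * M / r ^+ m.
Proof.
elim: m => [|m [C C0 IH]].
  exists 1 => // r M g s r0 M0 /size0nil -> Hg gM; rewrite expr0 divr1; split => // w /gM.
  by rewrite expr0 divr1 mul1r.
(* The factor [2 / q] of one Cauchy bound equals [20 * 2 ^+ m / r]. *)
exists (20 * 2 ^+ m * C); first by rewrite !mulr_ge0// exprn_ge0.
move=> r M g [//|j s] r0 M0 [sm] Hg gM /=.
have [Hs sM] := IH r M g s r0 M0 sm Hg gM.
pose q := r / 2 ^+ m / 10.
have r'0 : 0 < r / 2 ^+ m by rewrite divr_gt0// exprn_gt0.
have q0 : 0 < q by rewrite divr_gt0.
have rE : r / 2 ^+ m.+1 = r / 2 ^+ m - 5 * q.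
  by rewrite /q exprS; field; rewrite expf_neq0.
split; first by rewrite rE; exact: sep_hol_pd sM.
move=> w; rewrite rE => wr.
have : cabs (pd j (pds s g) w) <= 2 * (C * M / r ^+ m) / q.
  apply: (pd_bound (r / 2 ^+ m)) => //; apply: ostrip_le wr.
  by rewrite lerD2l lerN2 ler_peMl// ?ltW// ltr1n.
move/le_trans; apply; rewrite le_eqVlt; apply/orP; left; apply/eqP.
by rewrite /q exprS; field; rewrite !expf_neq0// gt_eqF.
Qed.

Lemma cembedD (x : 'rV[R]_n) (t : R) j :
  cembed (x + t *: unitv j) = cembed x + rc t *: delta_mx 0 j :> 'rV[R[i]]_n.
Proof.
apply/rowP => k; rewrite !mxE eqxx /= -[LHS]/(rc _) rcD rcM.
by congr (_ + _ * _); case: eqP.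
Qed.

Lemma ostrip_cembed (r : R) (x : 'rV[R]_n) : 0 < r -> ostrip r (cembed x).
Proof. by move=> r0 j; rewrite mxE /= normr0. Qed.

Lemma pcdiff_is_derive g j (x : 'rV[R]_n) d : pcdiff g j (cembed x) d ->
  is_derive x (unitv j) (fun y => complex.Re (g (cembed y))) (complex.Re d).
Proof.
move=> D; apply/is_derive_eps => e e0; have [r r0 H] := D e e0.
exists r => // h hr; have := H (rc h); rewrite cabs_real => /(_ hr).
apply: le_trans; apply: le_trans (Re_le_cabs _).
rewrite cembedD add0r scale0r addr0; case: (g _) => a1 a2; case: (g _) => b1 b2.
by case: d {D H} => d1 d2 /=; rewrite mulr0 subr0.
Qed.

Lemma analytic_on_strip_sep_hol (r : R) (g : 'rV[CC R]_n -> CC R) :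
  analytic_on_strip r g -> sep_hol r g.
Proof.
move=> [U [_ [SU dU]]] z zr j.
have /dU/(diff_derivable (v := delta_mx 0 j))/derivableP : U z.
  by apply: SU => k; exact: ltW.
move=> /is_derive_eps H; exists ('D_(delta_mx 0 j) g z) => e e0.
have [|s s0 Hs] := H (rc e); first by rewrite (rc_lt 0).
(* A positive element of [R[i]] is real, so the radius [s] yields one in [R]. *)
have sE : s = rc (complex.Re s).
  by move: s0; case: (s) => a b; rewrite ltcE /= => /andP[/eqP -> _].
exists (complex.Re s); first by rewrite -rc_lt -sE.
move=> h; rewrite cabs_le => hs; rewrite add0r scale0r addr0 cabs_le rcM -cabsE.
by apply: Hs; rewrite sE.
Qed.

End several_variables.

(** * Weighted integrals and the modulus of continuity *)

Lemma int_itv_le {R : realType} (f g : R -> R) (a b : R) :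
  {within `[a, b], continuous f} -> {within `[a, b], continuous g} ->
  (forall x, a <= x <= b -> f x <= g x) -> int_itv f a b <= int_itv g a b.
Proof.
move=> cf cg fg; apply: le_Rintegral.
- exact: measurable_itv.
- exact: integrable_itv_continuous.
- exact: integrable_itv_continuous.
- by move=> x; rewrite /= in_itv /=; exact: fg.
Qed.

Lemma int_itvZ {R : realType} (f : R -> R) (k a b : R) :
  {within `[a, b], continuous f} -> int_itv (fun x => k * f x) a b = k * int_itv f a b.
Proof. by move=> cf; rewrite -RintegralZl//; exact: integrable_itv_continuous. Qed.

Lemma within_continuous_cst {R : realType} (k a b : R) :
  {within `[a, b], continuous (fun=> k)}.
Proof. by move=> x; exact: cvg_cst. Qed.

Lemma within_continuousM {R : realType} (f g : R -> R) (A : set R) :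
  {within A, continuous f} -> {within A, continuous g} ->
  {within A, continuous (fun x => f x * g x)}.
Proof. by move=> cf cg x; apply: cvgM; [exact: cf|exact: cg]. Qed.

Section weights.
Context {R : realType} (phi : R -> R).
Hypothesis phi_ge0 : forall x : R, 0 <= x -> 0 <= phi x.
Hypothesis phi_mono : {in `[0, +oo[ &, {homo phi : x y / x <= y}}.
Hypothesis phi_cont : {within `[0, +oo[, continuous phi}.

Definition wt (m : nat) (t : R) : R := phi t / t ^+ m.

Lemma wt_ge0 m t : 0 < t -> 0 <= wt m t.
Proof. by move=> t0; rewrite /wt divr_ge0 ?exprn_ge0 ?phi_ge0// ltW. Qed.

Lemma wtS m t : 0 < t -> wt m t = t * wt m.+1 t.
Proof. by move=> t0; rewrite /wt exprS; field; rewrite expf_neq0 gt_eqF. Qed.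

Lemma phi_le x y : 0 < x -> x <= y -> phi x <= phi y.
Proof.
move=> x0 xy; apply: phi_mono => //; rewrite in_itv /= andbT ltW//.
exact: lt_le_trans xy.
Qed.

Lemma wt_continuous_pos m (A : set R) : A `<=` [set x | 0 < x] -> {within A, continuous (wt m)}.
Proof.
move=> A0; apply: within_continuousM.
  apply: continuous_subspaceW phi_cont => x /A0 /= x0.
  by rewrite in_itv /= andbT ltW.
apply/subspace_continuousP => x /A0 /= x0; apply: cvg_within_filter.
apply: cvgV; first by rewrite expf_neq0// gt_eqF.
exact: exprn_continuous.
Qed.

Lemma wt_continuous m (a b : R) : 0 < a -> {within `[a, b], continuous (wt m)}.
Proof.
move=> a0; apply: wt_continuous_pos => x; rewrite /= in_itv /= => /andP[ax _].
exact: lt_le_trans ax.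
Qed.

(** [wt m] need not be monotone, so numerator and denominator are bounded separately. *)
Lemma wt_bounds m x y t : 0 < x -> x <= t <= y ->
  phi x / y ^+ m <= wt m t <= phi y / x ^+ m.
Proof.
move=> x0 /andP[xt ty]; have t0 : 0 < t := lt_le_trans x0 xt.
have y0 : 0 < y := lt_le_trans t0 ty.
have invX (u v : R) : 0 < u -> u <= v -> (v ^+ m)^-1 <= (u ^+ m)^-1.
  move=> u0 uv; have v0 := lt_le_trans u0 uv.
  by rewrite lef_pV2 ?posrE ?exprn_gt0// lerXn2r// nnegrE ltW.
have inv0 (u : R) : 0 < u -> 0 <= (u ^+ m)^-1.
  by move=> u0; rewrite invr_ge0 exprn_ge0// ltW.
apply/andP; split; apply: ler_pM.
- exact/phi_ge0/ltW.
- exact: inv0.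
- exact: phi_le.
- exact: invX.
- exact/phi_ge0/ltW.
- exact: inv0.
- exact: phi_le.
- exact: invX.
Qed.

Lemma int_wt_ge0 m x y : 0 < x -> 0 <= int_itv (wt m) x y.
Proof.
move=> x0; apply: Rintegral_ge0 => t; rewrite /= in_itv /= => /andP[xt _].
by apply: wt_ge0; exact: lt_le_trans xt.
Qed.

(** From [wt m t = t * wt m.+1 t] with [t] between [x] and [y]; for [m = k + 1] this is the
    integrated form of dB = -x dA. *)
Lemma int_wtS m x y : 0 < x -> x <= y ->
  x * int_itv (wt m.+1) x y <= int_itv (wt m) x y <= y * int_itv (wt m.+1) x y.
Proof.
move=> x0 xy; rewrite -!int_itvZ; try exact: wt_continuous.
apply/andP; split; apply: int_itv_le; try exact: wt_continuous;
  try by apply: within_continuousM; [exact: within_continuous_cst|exact: wt_continuous].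
  move=> t /andP[xt ty]; have t0 : 0 < t := lt_le_trans x0 xt.
  by rewrite [leRHS]wtS// ler_wpM2r// wt_ge0.
move=> t /andP[xt ty]; have t0 : 0 < t := lt_le_trans x0 xt.
by rewrite [leLHS]wtS// ler_wpM2r// wt_ge0.
Qed.

Lemma wt_measurable_pos m (A : set R) : measurable A -> A `<=` [set x | 0 < x] ->
  measurable_fun A (wt m).
Proof.
by move=> mA A0; apply: subspace_continuous_measurable_fun => //; exact: wt_continuous_pos.
Qed.

(** Monotone convergence with values in the extended reals: one statement covers the divergent
    integral, making A unbounded, and the convergent one, making B small. *)
Lemma int_wt_exhaust m (b : R) : 0 < b ->
  (int_itv (wt m) (b / i.+1%:R) b)%:E @[i --> \oo] -->
  (\int[lebesgue_measure]_(x in `]0%R, b]) (wt m x)%:E)%E.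
Proof.
move=> b0; pose F (i : nat) : set R := `[b / i.+1%:R, b]%classic.
have F0 i : F i `<=` [set x | 0 < x].
  move=> x; rewrite /F /= in_itv /= => /andP[h _]; apply: lt_le_trans h.
  by rewrite divr_gt0.
have UF : \bigcup_i F i = `]0, b]%classic.
  apply/seteqP; split=> x /=.
    move=> [i _ Fx]; have := F0 i x Fx; move: Fx.
    by rewrite /F /= !in_itv /= => /andP[_ ->] ->.
  rewrite in_itv /= => /andP[x0 xb].
  have bx0 : 0 <= b / x by rewrite divr_ge0// ltW.
  exists (Num.bound (b / x)) => //; rewrite /F /= in_itv /= xb andbT.
  rewrite ler_pdivrMr// mulrC -ler_pdivrMr//.
  by apply: le_trans (ltW (archi_boundP bx0)) _; rewrite ler_nat.
rewrite -UF.
have -> : (fun i : nat => (int_itv (wt m) (b / i.+1%:R) b)%:E) =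
    (fun i => \int[lebesgue_measure]_(x in F i) (wt m x)%:E)%E.
  apply: funext => i; rewrite /int_itv /Rintegral fineK//.
  apply: integrable_fin_num => //; apply: integrable_itv_continuous.
  by apply: wt_continuous; rewrite divr_gt0.
apply: (@ge0_nondecreasing_set_cvg_integral _ (measurableTypeR R) R F (EFin \o wt m)).
- move=> i j ij; rewrite subsetEset /F => x /=; rewrite !in_itv /= => /andP[h ->].
  rewrite andbT; apply: le_trans h; rewrite ler_wpM2l ?(ltW b0)//.
  by rewrite lef_pV2 ?posrE// ler_nat.
- by move=> i; exact: measurable_itv.
- by move=> i; apply/measurable_EFinP; apply: wt_measurable_pos => //; exact: measurable_itv.
- by move=> i x /F0 /= x0; rewrite lee_fin wt_ge0.
Qed.

Lemma int_wt_unbounded m (b M : R) : 0 < b ->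
  (\int[lebesgue_measure]_(x in `](0 : R)%R, b]) (wt m x)%:E = +oo)%E ->
  exists2 x, 0 < x <= b & M < int_itv (wt m) x b.
Proof.
move=> b0 E; have := int_wt_exhaust m b b0; rewrite E => /cvgey_gt/(_ (M + 1)).
move=> [N _ /(_ N (leqnn N))]; rewrite lte_fin => h.
exists (b / N.+1%:R); last by rewrite (lt_trans _ h)// ltrDl.
by rewrite divr_gt0//= ler_pdivrMr// ler_peMr ?ler1n// ltW.
Qed.

(** Finiteness is assumed on []0, 1]] while the integrals run up to [b]; beyond 1 the integrand is
    continuous on a compact interval. *)
Lemma wt_integrable m (b : R) :
  (\int[lebesgue_measure]_(x in `](0 : R)%R, (1 : R)%R]) (wt m x)%:E < +oo)%E ->
  lebesgue_measure.-integrable `]0, b] (EFin \o wt m).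
Proof.
move=> E; have pos (c : R) : `]0, c]%classic `<=` [set x : R | 0 < x].
  by move=> x; rewrite /= in_itv /= => /andP[].
have I1 : lebesgue_measure.-integrable `]0, 1] (EFin \o wt m).
  apply/integrableP; split.
    by apply/measurable_EFinP; apply: wt_measurable_pos => //; exact: pos.
  apply: le_lt_trans E; rewrite le_eqVlt; apply/orP; left; apply/eqP.
  apply: eq_integral => x; rewrite inE => /pos /= x0.
  by rewrite ger0_norm// wt_ge0.
have [b1|b1] := leP b 1.
  by apply: integrableS I1 => //; apply: subset_itvl; rewrite bnd_simp.
apply/integrableP; split.
  by apply/measurable_EFinP; apply: wt_measurable_pos => //; exact: pos.
have U : `]0, b]%classic = `]0, 1]%classic `|` `]1, b]%classic :> set R.
  by rewrite -itv_bndbnd_setU// bnd_simp// ltW.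
rewrite U ge0_integral_setU//=.
- have /integrableP[_ h1] := I1.
  have /integrableP[_ h2] : lebesgue_measure.-integrable `]1, b] (EFin \o wt m).
    have I2 : lebesgue_measure.-integrable `[1, b] (EFin \o wt m).
      by apply: integrable_itv_continuous; exact: wt_continuous.
    by apply: integrableS I2 => //; apply: subset_itvr; rewrite bnd_simp.
  exact: lte_add_pinfty.
- rewrite -U; do 2 apply: measurableT_comp => //.
  by apply: wt_measurable_pos => //; exact: pos.
- apply/disj_setPS => x [/=]; rewrite !in_itv /= => /andP[_ x1] /andP[x2 _].
  by move: x1; rewrite leNgt x2.
Qed.

Definition int0 (m : nat) (b : R) : R := Rintegral lebesgue_measure `]0, b] (wt m).

Lemma int0B m (x y : R) : lebesgue_measure.-integrable `]0, y] (EFin \o wt m) ->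
  0 < x -> x <= y -> int0 m y - int0 m x = int_itv (wt m) x y.
Proof.
move=> I x0 xy.
have := @Rintegral_itvB R (wt m) (BRight 0) (BRight y) x I.
rewrite !bnd_simp => /(_ (ltW x0) xy) E; rewrite [LHS]E.
rewrite Rintegral_itv_obnd_cbnd//.
by apply: integrableS I => //; apply: subset_itvr; rewrite bnd_simp ltW.
Qed.

Lemma int0_ge0 m x : 0 <= int0 m x.
Proof.
by apply: Rintegral_ge0 => t; rewrite /= in_itv /= => /andP[t0 _]; exact: wt_ge0.
Qed.

Lemma int0_small m (b e : R) : 0 < b -> 0 < e ->
  lebesgue_measure.-integrable `]0, b] (EFin \o wt m) ->
  exists2 x, 0 < x <= b & int0 m x <= e.
Proof.
move=> b0 e0 I.
have := int_wt_exhaust m b b0.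
have -> : (\int[lebesgue_measure]_(x in `]0%R, b]) (wt m x)%:E = (int0 m b)%:E)%E.
  by rewrite /int0 /Rintegral fineK//; exact: integrable_fin_num.
move=> /fine_cvgP[_ /cvgrPdist_le/(_ e e0)[N _ /(_ N (leqnn N)) /= h]].
have xb : 0 < b / N.+1%:R <= b.
  by rewrite divr_gt0//= ler_pdivrMr// ler_peMr ?ler1n// ltW.
exists (b / N.+1%:R) => //; have /andP[h1 h2] := xb.
move: h; rewrite -(int0B m _ _ I h1 h2) opprB addrCA subrr addr0.
by rewrite ger0_norm// int0_ge0.
Qed.

End weights.

Lemma near_right0 {R : realType} (P : R -> Prop) (r : R) : 0 < r ->
  (forall x, 0 < x < r -> P x) -> \forall x \near (0 : R)^'+, P x.
Proof.
move=> r0 H; apply: filterS (filterI (nbhs_right_gt 0) (nbhs_right_lt r0)) => x [x0 xr].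
by apply: H; rewrite x0.
Qed.

(* A and B abstract the integrals of phi t / t^(k+2) over [x, eps] and of phi t / t^(k+1) over
   (0, x]; the line g A(x) + B(x) is minimal at x = g. *)
Section balance.
Context {R : realType} (eps : R) (A B : R -> R).
Hypothesis eps0 : 0 < eps.
Hypothesis A_eps : A eps = 0.
Hypothesis A_mono : forall x y : R, 0 < x -> x <= y -> y <= eps -> A y <= A x.
Hypothesis B_ge0 : forall x : R, 0 < x -> x <= eps -> 0 <= B x.
Hypothesis AB_le : forall x y : R, 0 < x -> x <= y -> y <= eps -> x * (A x - A y) <= B y - B x.
Hypothesis AB_ge : forall x y : R, 0 < x -> x <= y -> y <= eps -> B y - B x <= y * (A x - A y).
Hypothesis A_unbounded : forall M : R, exists2 x : R, 0 < x <= eps & M < A x.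
Hypothesis B_small : forall e : R, 0 < e -> exists2 x : R, 0 < x <= eps & B x <= e.
Hypothesis A_lipschitz : forall x0 : R, 0 < x0 -> exists2 K : R, 0 <= K &
  forall x y : R, x0 <= x -> x <= y -> y <= eps -> A x - A y <= K * (y - x).

Definition wmod (g : R) : R := g * A g + B g.

Lemma A_ge0 x : 0 < x -> x <= eps -> 0 <= A x.
Proof. by move=> x0 xe; rewrite -A_eps; exact: A_mono. Qed.

Lemma B_mono x y : 0 < x -> x <= y -> y <= eps -> B x <= B y.
Proof.
move=> x0 xy ye; rewrite -subr_ge0; apply: le_trans (AB_le _ _ x0 xy ye).
by rewrite mulr_ge0 ?subr_ge0 ?(ltW x0)//; exact: A_mono.
Qed.

(** If [B] vanished at [x], then by [AB_le] no value of [A] on []0, x]] could exceed [A x]. *)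
Lemma B_gt0 x : 0 < x -> x <= eps -> 0 < B x.
Proof.
move=> x0 xe; have [y /andP[y0 ye] yA] := A_unbounded (A x).
have yx : y <= x by rewrite leNgt; apply/negP => /ltW h; move: (A_mono _ _ x0 h ye); rewrite leNgt yA.
have := AB_le _ _ y0 yx xe; rewrite lerBrDr; apply: lt_le_trans.
by rewrite ltr_wpDr ?B_ge0// mulr_gt0// subr_gt0.
Qed.

(** The derivative of [wmod] is formally [A], which is nonnegative and decreases; [AB_le] and
    [AB_ge] give the consequence without differentiating. *)
Lemma wmod_increment x y : 0 < x -> x <= y -> y <= eps ->
  0 <= wmod y - wmod x <= (y - x) * A x.
Proof.
move=> x0 xy ye; have y0 := lt_le_trans x0 xy.
have := AB_le _ _ x0 xy ye; have := AB_ge _ _ x0 xy ye.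
have : 0 <= (y - x) * A y by rewrite mulr_ge0 ?subr_ge0// A_ge0.
rewrite /wmod; move: (A x) (A y) (B x) (B y) => a a' b b'.
by rewrite !mulrBr !mulrBl => h1 h2 h3; apply/andP; split; lra.
Qed.

Lemma wmod_gt0 x : 0 < x -> x <= eps -> 0 < wmod x.
Proof. by move=> x0 xe; rewrite ltr_wpDl ?B_gt0// mulr_ge0 ?A_ge0// ltW. Qed.

(** For [g <= x], [AB_le] gives [wmod g <= g * A x + B x]: first [x] makes [B x] small, then [g]
    makes [g * A x] small. *)
Lemma wmod_small e : 0 < e -> exists2 r, 0 < r & forall g, 0 < g < r -> g <= eps /\ wmod g <= e.
Proof.
move=> e0; have e20 : 0 < e / 2 by rewrite divr_gt0.
have [x /andP[x0 xe] Bx] := B_small _ e20.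
have k0 : 0 < A x + 1 by rewrite ltr_wpDl// A_ge0.
exists (Num.min x (e / 2 / (A x + 1))); first by rewrite lt_min x0 divr_gt0.
move=> g /andP[g0]; rewrite lt_min => /andP[/ltW gx].
rewrite ltr_pdivlMr// => ge; split; first exact: le_trans gx xe.
have := AB_le _ _ g0 gx xe; move: ge Bx; rewrite /wmod mulrBr mulrDr.
move: (g * A g) (g * A x) (B g) (B x) => a a' b b' h1 h2 h3; lra.
Qed.

Lemma modulus_wmod : modulus eps wmod.
Proof.
split => //; split.
  move=> x y; rewrite !in_itv /= => /andP[x0 _] /andP[_ ye] xy.
  by have /andP[] := wmod_increment _ _ x0 xy ye; rewrite subr_ge0.
split.
  apply/subspace_continuousP => x; rewrite /= in_itv /= => /andP[x0 xe].
  apply/cvgrPdist_le => e e0.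
  have x20 : 0 < x / 2 by rewrite divr_gt0.
  have x2e : x / 2 <= eps by rewrite (le_trans _ xe)// ler_pdivrMr// ler_peMr ?ler1n// ltW.
  pose K := A (x / 2); have K0 : 0 <= K by exact: A_ge0.
  have K1 : 0 < K + 1 by rewrite ltr_wpDl.
  have r0 : 0 < Num.min (x / 2) (e / (K + 1)) by rewrite lt_min x20 divr_gt0.
  rewrite near_withinE; apply: (filterS _ (@nbhsx_ballx _ R x _ r0)) => y.
  rewrite /ball /= lt_min in_itv /= => /andP[d1 d2] /andP[y0 ye].
  rewrite ltr_pdivlMr// in d2.
  have yx2 : x / 2 <= y by have := le_lt_trans (ler_norm (x - y)) d1; lra.
  have xx2 : x / 2 <= x by rewrite ler_pdivrMr// ler_peMr ?ler1n// ltW.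
  have key u v : x / 2 <= u -> u <= v -> v <= eps -> `|wmod v - wmod u| <= `|v - u| * K.
    move=> hu uv ve; have /andP[h1 h2] := wmod_increment _ _ (lt_le_trans x20 hu) uv ve.
    have vu : 0 <= v - u by rewrite subr_ge0.
    rewrite (ger0_norm h1) (ger0_norm vu); apply: (le_trans h2).
    by rewrite ler_wpM2l//; apply: A_mono => //; exact: le_trans uv ve.
  have dK : `|x - y| * K <= e.
    by apply: le_trans (ltW d2); rewrite ler_wpM2l// lerDl.
  have [xy|/ltW yx] := leP x y; last exact: le_trans (key _ _ yx2 yx xe) dK.
  by rewrite distrC; apply: le_trans (key _ _ xx2 xy ye) _; rewrite distrC.
split; first by move=> x /andP[x0 xe]; exact: wmod_gt0.
split.
  apply/cvgrPdist_le => e e0; have [r r0 H] := wmod_small e e0.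
  apply: (near_right0 _ r r0) => x xr; have [xe we] := H x xr.
  have /andP[x0 _] := xr.
  by rewrite sub0r normrN ger0_norm// ltW// wmod_gt0.
(* Where [A] exceeds 1, [g <= g * A g <= wmod g], so [g / wmod g] is at most 1. *)
have [x /andP[x0 xe] Ax] := A_unbounded 1.
exists 1, x; split => // g /andP[g0 /ltW gx]; have ge := le_trans gx xe.
rewrite ler_pdivrMr ?wmod_gt0// mul1r /wmod.
apply: le_trans (_ : g * A g <= _); last by rewrite lerDl B_ge0.
by rewrite ler_peMr ?(ltW g0)// (le_trans (ltW Ax))//; exact: A_mono.
Qed.

(** Intermediate value theorem for [g * A l - B l]: it is at most 0 at [eps], where [A] vanishes,
    and positive at some small [x] because [A] is unbounded. *)
Lemma balance_point g : 0 < g -> exists2 l, 0 < l <= eps & g * A l = B l.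
Proof.
move=> g0; have [x /andP[x0 xe] Ax] := A_unbounded (B eps / g).
rewrite ltr_pdivrMr// mulrC in Ax.
have [K K0 HK] := A_lipschitz _ x0.
have C : {within `[x, eps], continuous (fun l => g * A l - B l)}.
  apply: within_itv_continuous_eps => u /andP[xu ue] e e0.
  pose k := (g + eps) * K + 1.
  have k0 : 0 < k by rewrite ltr_wpDl// mulr_ge0// addr_ge0// ltW.
  have key s t : x <= s -> s <= t -> t <= eps ->
      `|(g * A t - B t) - (g * A s - B s)| <= k * `|t - s|.
    move=> xs st te; have s0 := lt_le_trans x0 xs.
    have h1 := HK _ _ xs st te; have h2 := AB_ge _ _ s0 st te.
    have ts : 0 <= t - s by rewrite subr_ge0.
    have h3 : 0 <= A s - A t by rewrite subr_ge0 A_mono.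
    have h4 : 0 <= B t - B s by rewrite subr_ge0 B_mono.
    rewrite distrC ger0_norm; last first.
      rewrite (_ : _ - _ = g * (A s - A t) + (B t - B s)); last by ring.
      by rewrite addr_ge0// mulr_ge0// ltW.
    rewrite (_ : _ - _ = g * (A s - A t) + (B t - B s)); last by ring.
    rewrite ger0_norm//.
    have h5 : t * (A s - A t) <= eps * (K * (t - s)).
      by apply: ler_pM => //; exact: ltW (lt_le_trans s0 st).
    have h6 : g * (A s - A t) <= g * (K * (t - s)) by rewrite ler_wpM2l// ltW.
    apply: (le_trans (lerD h6 (le_trans h2 h5))).
    by rewrite -mulrDl mulrA ler_wpM2r// lerDl.
  exists (e / k); first by rewrite divr_gt0.
  move=> v /andP[xv ve]; rewrite ltr_pdivlMr// mulrC => /ltW uv.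
  have [h|/ltW h] := leP u v; first exact: le_trans (key _ _ xu h ve) uv.
  by rewrite distrC; apply: le_trans (key _ _ xv h ue) _; rewrite distrC.
have [|c] := IVT (v := 0) xe C.
  rewrite A_eps mulr0 sub0r; apply/andP; split.
    by rewrite ge_min oppr_le0 B_ge0// orbT.
  rewrite le_max subr_ge0; apply/orP; left.
  by apply: le_trans (ltW Ax); exact: B_mono.
rewrite in_itv /= => /andP[xc ce] /eqP; rewrite subr_eq0 => /eqP E.
by exists c => //; rewrite ce (lt_le_trans x0 xc).
Qed.

Lemma wmod_le_line g l : 0 < g -> g <= eps -> 0 < l -> l <= eps -> wmod g <= g * A l + B l.
Proof.
move=> g0 ge l0 le; rewrite /wmod; have [gl|/ltW lg] := leP g l.
  have := AB_le _ _ g0 gl le; rewrite mulrBr.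
  move: (g * A g) (g * A l) (B g) (B l) => a b c d; lra.
have := AB_ge _ _ l0 lg ge; rewrite mulrBr.
move: (g * A g) (g * A l) (B g) (B l) => a b c d; lra.
Qed.

(** The common value of [g * A l] and [B l] is at most [g * A g] if [g <= l], and at most [B g] if
    [l <= g]. *)
Lemma line_le_wmod g l : 0 < g -> g <= eps -> 0 < l -> l <= eps -> g * A l = B l ->
  B l <= wmod g.
Proof.
move=> g0 ge l0 le E; rewrite /wmod; have [gl|/ltW lg] := leP g l.
  rewrite -E; apply: le_trans (_ : g * A g <= _); last by rewrite lerDl B_ge0.
  by rewrite ler_wpM2l ?(ltW g0)//; exact: A_mono.
apply: le_trans (B_mono _ _ l0 lg ge) _.
by rewrite lerDr mulr_ge0 ?A_ge0// ltW.
Qed.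

Lemma balance_function : exists L : R -> R,
  (\forall g \near 0^'+, 0 < L g) /\ L g @[g --> 0^'+] --> 0 /\
  asym_eq wmod (fun g => g * A (L g)) /\
  asym_eq (fun g => g * A (L g)) (fun g => B (L g)).
Proof.
have /choice[L LP] : forall g : R, exists l, 0 < l <= eps /\ (0 < g -> g * A l = B l).
  move=> g; have [g0|g0] := ltP 0 g; last by exists eps; rewrite eps0 lexx.
  by have [l l1 l2] := balance_point g g0; exists l.
have LE g : 0 < g -> g * A (L g) = B (L g) by have [_ h] := LP g.
exists L; split.
  by apply: (near_right0 _ 1) => // g _; have [/andP[]] := LP g.
split.
  apply/cvgrPdist_le => e e0; pose x := Num.min e eps.
  have x0 : 0 < x by rewrite lt_min e0.
  have xe : x <= eps by rewrite /x ge_min lexx orbT.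
  have k0 : 0 < A x + 1 by rewrite ltr_wpDl// A_ge0.
  apply: (near_right0 _ (B x / (A x + 1))); first by rewrite divr_gt0// B_gt0.
  move=> g /andP[g0]; rewrite ltr_pdivlMr// => gB.
  have [/andP[l0 le] _] := LP g.
  rewrite sub0r normrN gtr0_norm//; apply: le_trans (_ : x <= e); last by rewrite /x ge_min lexx.
  (* [x <= L g] would give [B x <= B (L g) = g * A (L g) <= g * A x], impossible for [g] below
     [B x / (A x + 1)]. *)
  rewrite leNgt; apply/negP => /ltW xl.
  have h1 := B_mono _ _ x0 xl le; rewrite -(LE g g0) in h1.
  have h2 : g * A (L g) <= g * A x by rewrite ler_wpM2l ?(ltW g0)//; exact: A_mono.
  by move: gB; rewrite mulrDr mulr1 ltNge (le_trans h1)// (le_trans h2)// lerDl ltW.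
split.
  exists 1, 2, eps; split => //; split; first exact: ler1n.
  split => // g /andP[g0 /ltW ge]; have [/andP[l0 le] _] := LP g.
  rewrite mul1r; split; first by rewrite LE//; apply: line_le_wmod => //; exact: LE.
  by apply: le_trans (wmod_le_line _ _ g0 ge l0 le) _; rewrite -LE// mulrDl mul1r.
exists 1, 1, eps; split => //; split => //; split => // g /andP[g0 _].
by rewrite !mul1r LE.
Qed.

End balance.

(** * Term-by-term differentiation *)

Lemma norm_row_coord_le {R : realType} {n : nat} (v : 'rV[R]_n) (i : 'I_n) : `|v 0 i| <= `|v|.
Proof.
by rewrite -[leRHS]/(mx_norm v) mx_normrE (le_bigmax _ (fun ij => `|v ij.1 ij.2|) (0, i)).
Qed.

Lemma is_derive_line {R : realType} {V : normedModType R} (f : V -> R) (x v : V) (t d : R) :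
  is_derive (x + t *: v) v f d -> is_derive t 1 (fun s : R => f (x + s *: v)) d.
Proof.
move=> /is_derive_eps D; apply/is_derive_eps => e e0; have [r r0 H] := D e e0.
by exists r => // h hr; rewrite scaler1 scalerDl (addrA x); exact: H.
Qed.

Lemma directional_lipschitz {R : realType} {V : normedModType R} (f df : V -> R) (v : V) (K : R) :
  (forall x, is_derive x v f (df x)) -> (forall x, `|df x| <= K) ->
  forall x (h : R), `|f (x + h *: v) - f x| <= K * `|h|.
Proof.
move=> Df dK x h; pose F (s : R) := f (x + s *: v).
have DF (t : R) : is_derive t (1 : R) F (df (x + t *: v)) by apply: is_derive_line; exact: Df.
have F0 : F 0 = f x by rewrite /F scale0r addr0.
rewrite -F0 -[f _]/(F h); have [h0|/ltW h0] := leP 0 h.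
  rewrite (ger0_norm h0) -[in leRHS](subr0 h); apply: mean_value_bound => // t _.
  by exists (df (x + t *: v)).
rewrite (ler0_norm h0) -[in leRHS](sub0r h) distrC; apply: mean_value_bound => // t _.
by exists (df (x + t *: v)).
Qed.

(** The points [z m] take the first [m] coordinates from [x] and the rest from [y]; each of the [n]
    steps moves by at most the sup norm of [x - y]. *)
Lemma coordinatewise_lipschitz {R : realType} {n : nat} (f : 'rV[R]_n -> R) (K : R) :
  0 <= K -> (forall j x (h : R), `|f (x + h *: unitv j) - f x| <= K * `|h|) ->
  forall x y, `|f x - f y| <= n%:R * K * `|x - y|.
Proof.
move=> K0 H x y.
pose z (m : nat) : 'rV[R]_n := \row_k (if (k < m)%N then x 0 k else y 0 k).
have z0 : z 0%N = y by apply/rowP => k; rewrite mxE.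
have zn : z n = x by apply/rowP => k; rewrite mxE ltn_ord.
have S m : (m <= n)%N -> `|f (z m) - f (z 0%N)| <= m%:R * K * `|x - y|.
  elim: m => [|m IH] mn; first by rewrite subrr normr0 !mul0r.
  have {}IH := IH (ltnW mn); pose j := Ordinal mn.
  have E : z m.+1 = z m + (x - y) 0 j *: unitv j.
    apply/rowP => k; rewrite !mxE eqxx /= ltnS leq_eqVlt.
    have [->|kj] := eqVneq k j; first by rewrite /= eqxx ltnn mulr1 subrKC.
    by rewrite -(inj_eq val_inj) /= in kj; rewrite (negbTE kj) mulr0 addr0.
  rewrite -(subrKA (f (z m))) (le_trans (ler_normD _ _))//.
  rewrite -natr1 mulrDl mulrDl mul1r addrC lerD// E (le_trans (H _ _ _))//.
  by rewrite ler_wpM2l// norm_row_coord_le.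
by have := S n (leqnn n); rewrite zn z0.
Qed.

Lemma norm_lim_le {R : realType} (u : nat -> R) (l K : R) (N0 : nat) :
  u N @[N --> \oo] --> l -> (forall N, (N0 <= N)%N -> `|u N| <= K) -> `|l| <= K.
Proof.
move=> ul uK; apply/ler_addgt0Pr => e e0.
have [N _ HN] := (cvgrPdist_le _ _).1 ul e e0.
have h1 := HN _ (leq_maxl N N0); have h2 := uK _ (leq_maxr N N0).
rewrite -(subrK (u (maxn N N0)) l) (le_trans (ler_normD _ _))// addrC.
exact: lerD h2 h1.
Qed.

Lemma bounded_series_tail {R : realType} (c : nat -> R) (S e : R) :
  (forall i, 0 <= c i) -> (forall N, \sum_(0 <= i < N) c i <= S) -> 0 < e ->
  exists N0, forall N, (N0 <= N)%N -> \sum_(N0 <= i < N) c i <= e.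
Proof.
move=> c0 cS e0; pose s N := \sum_(0 <= i < N) c i.
have hs : has_sup (range s).
  by split; [exists (s 0%N), 0%N|exists S => _ [N _ <-]; exact: cS].
have [_ [N0 _ <-] h] := sup_adherent e0 hs.
exists N0 => N N0N; have : s N <= sup (range s).
  by apply: ub_le_sup; [case: hs|exists N].
have -> : s N = s N0 + \sum_(N0 <= i < N) c i by rewrite /s -big_cat_nat.
by move: h; move: (sup _) => q; lra.
Qed.

Lemma bounded_series_cvg {R : realType} (u c : nat -> R) (S : R) :
  (forall i, `|u i| <= c i) -> (forall N, \sum_(0 <= i < N) c i <= S) ->
  exists l : R, \sum_(0 <= i < N) u i @[N --> \oo] --> l.
Proof.
move=> uc cS; suff cu : cvgn (series u) by exists (limn (series u)); exact: cu.
apply: normed_cvg; apply: nondecreasing_is_cvgn.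
  by apply: nondecreasing_series => i _ _; exact: normr_ge0.
exists S => _ [N _ <-]; apply: le_trans (cS N); apply: ler_sum => i _; exact: uc.
Qed.

(** Split at [N0]: the head is a finite sum of derivable functions; the tail is controlled by the
    tail of [c], since each [a i] is Lipschitz along [v] with constant [c i]. That tail counts
    twice, for increments and for derivatives. *)
Lemma is_derive_series {R : realType} {V : normedModType R} (a da : nat -> V -> R)
    (c : nat -> R) (S : R) (f : V -> R) (x v : V) (d : R) :
  (forall i y, is_derive y v (a i) (da i y)) ->
  (forall i y, `|da i y| <= c i) -> (forall N, \sum_(0 <= i < N) c i <= S) ->
  (forall y, \sum_(0 <= i < N) a i y @[N --> \oo] --> f y) ->
  \sum_(0 <= i < N) da i x @[N --> \oo] --> d ->
  is_derive x v f d.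
Proof.
move=> Da dc cS af dd; apply/is_derive_eps => e e0.
have c0 i : 0 <= c i := le_trans (normr_ge0 _) (dc i x).
have e40 : 0 < e / 4 by rewrite divr_gt0.
have [N0 HN0] := bounded_series_tail c S _ c0 cS e40.
have /is_derive_eps : is_derive x v (\sum_(i < N0) a i) (\sum_(i < N0) da i x).
  by apply: is_derive_sum => i; exact: Da.
move=> /(_ (e / 2))[|r r0 Hr]; first by rewrite divr_gt0.
exists r => // h hr.
have L : \sum_(0 <= i < N) (a i (x + h *: v) - a i x - da i x * h) @[N --> \oo] -->
    f (x + h *: v) - f x - d * h.
  have -> : (fun N => \sum_(0 <= i < N) (a i (x + h *: v) - a i x - da i x * h)) =
     (fun N => \sum_(0 <= i < N) a i (x + h *: v) - \sum_(0 <= i < N) a i x -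
               (\sum_(0 <= i < N) da i x) * h).
    by apply: funext => N; rewrite mulr_suml -!sumrB.
  by apply: cvgB; [apply: cvgB; exact: af|apply: cvgM => //; exact: cvg_cst].
apply: (norm_lim_le _ _ _ N0 L) => N N0N.
rewrite (big_cat_nat (leq0n N0) N0N)//= (le_trans (ler_normD _ _))//.
have -> : e * `|h| = e / 2 * `|h| + (e / 4 + e / 4) * `|h| by field.
apply: lerD.
  apply: le_trans (Hr h hr); rewrite le_eqVlt; apply/orP; left; apply/eqP.
  by rewrite !fct_sumE mulr_suml -!sumrB big_mkord.
apply: (le_trans (ler_norm_sum _ _ _)).
apply: (@le_trans _ _ (\sum_(N0 <= i < N) (c i * `|h| + c i * `|h|))).
  apply: ler_sum => i _; rewrite (le_trans (ler_normB _ _))// lerD//.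
    exact: (directional_lipschitz (a i) (da i) v (c i)).
  by rewrite normrM ler_wpM2r.
rewrite big_split/= -mulr_suml mulrDl.
by rewrite lerD// ler_wpM2r// HN0.
Qed.

(** * Comparison of dyadic sums with integrals *)

Section dyadic_sums.
Context {R : realType} (phi : R -> R) (k : nat) (eps : R) (A B : R -> R).
Hypothesis phi_ge0 : forall x : R, 0 <= x -> 0 <= phi x.
Hypothesis phi_mono : {in `[0, +oo[ &, {homo phi : x y / x <= y}}.
Hypothesis phi_cont : {within `[0, +oo[, continuous phi}.
Hypothesis A_int : forall x y : R, 0 < x -> x <= y -> y <= eps ->
  A x - A y = int_itv (wt phi k.+2) x y.
Hypothesis B_int : forall x y : R, 0 < x -> x <= y -> y <= eps ->
  B y - B x = int_itv (wt phi k.+1) x y.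

Lemma int_wt_lower m (r d x y : R) : 0 < r -> r <= x -> x <= y -> y <= d ->
  phi r / d ^+ m * (y - x) <= int_itv (wt phi m) x y.
Proof.
move=> r0 rx xy yd; rewrite -int_itv_cst//; apply: int_itv_le.
- exact: within_continuous_cst.
- by apply: wt_continuous => //; exact: lt_le_trans rx.
move=> t /andP[xt ty]; have rt := le_trans rx xt; have td := le_trans ty yd.
have rtd : r <= t <= d by rewrite rt.
by have /andP[] := wt_bounds phi phi_ge0 phi_mono m r d t r0 rtd.
Qed.

(** On [[r, 2 * r]], of length [r], the weight is at least [phi r / (2 * r) ^+ k.+1]; a difference
    of [B] is used so that the sum telescopes. *)
Lemma dyadic_term_le (r : R) : 0 < r -> 2 * r <= eps ->
  phi r / r ^+ k <= 2 ^+ k.+1 * (B (2 * r) - B r).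
Proof.
move=> r0 re; have r2 : r <= 2 * r by rewrite ler_peMl ?ler1n// ltW.
rewrite B_int//; apply: le_trans (_ : 2 ^+ k.+1 * (phi r / (2 * r) ^+ k.+1 * (2 * r - r)) <= _).
  rewrite le_eqVlt; apply/orP; left; apply/eqP; rewrite exprMn !exprS; field.
  by rewrite !expf_neq0 ?gt_eqF.
by rewrite ler_wpM2l ?exprn_ge0//; exact: int_wt_lower.
Qed.

(* The integral over (0, l] of (phi t / t^(k+1)) min(1, g / t). *)
Definition truncated_weight (g l : R) : R := if l <= g then B l else B g + g * (A g - A l).

(** Three cases, as [[r, 2 * r]] lies below, across or above [g]. Beyond [g] the weight has one more
    power of [t] in the denominator, and [t <= 2 * r] costs one more factor 2. *)
Lemma dyadic_truncated_term_le (r g t : R) : 0 < r -> 2 * r <= eps -> 0 < g -> g <= eps ->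
  t <= phi r / r ^+ k -> t <= g * (phi r / r ^+ k.+1) ->
  t <= 2 ^+ k.+2 * (truncated_weight g (2 * r) - truncated_weight g r).
Proof.
move=> r0 re g0 ge t1 t2.
have r2 : r <= 2 * r by rewrite ler_peMl ?ler1n// ltW.
have d0 : 0 < 2 * r by rewrite mulr_gt0.
pose P := phi r / (2 * r) ^+ k.+1.
have P0 : 0 <= P by rewrite divr_ge0 ?exprn_ge0 ?phi_ge0// ltW.
have rk : r ^+ k != 0 by rewrite expf_neq0 ?gt_eqF.
have t1' : t <= 2 ^+ k.+2 * (P * r / 2).
  apply: le_trans t1 _; rewrite le_eqVlt; apply/orP; left; apply/eqP.
  by rewrite /P exprMn !exprS; field; rewrite !expf_neq0 ?gt_eqF.
have t2' : t <= 2 ^+ k.+2 * (P * g / 2).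
  apply: le_trans t2 _; rewrite le_eqVlt; apply/orP; left; apply/eqP.
  by rewrite /P exprMn !exprS; field; rewrite !expf_neq0 ?gt_eqF.
have Bl x y : r <= x -> x <= y -> y <= 2 * r -> P * (y - x) <= B y - B x.
  move=> rx xy yd; rewrite B_int//.
  - exact: int_wt_lower.
  - exact: lt_le_trans rx.
  - exact: le_trans re.
have Al x y : r <= x -> x <= y -> y <= 2 * r -> P / (2 * r) * (y - x) <= A x - A y.
  move=> rx xy yd; rewrite A_int//.
  - have -> : P / (2 * r) = phi r / (2 * r) ^+ k.+2.
      by rewrite /P exprMn [(2 * r) ^+ k.+2]exprMn !exprS; field; rewrite !expf_neq0 ?gt_eqF.
    exact: int_wt_lower.
  - exact: lt_le_trans rx.
  - exact: le_trans re.
have c0 : 0 <= 2 ^+ k.+2 :> R by rewrite exprn_ge0.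
rewrite /truncated_weight; have [dg|gd] := leP (2 * r) g.
  rewrite (le_trans r2 dg); apply: le_trans t1' _; rewrite ler_wpM2l//.
  apply: le_trans (Bl r (2 * r) _ _ _) => //.
  have Pr : 0 <= P * r by rewrite mulr_ge0// ltW.
  have -> : P * (2 * r - r) = P * r by ring.
  by rewrite ler_pdivrMr// ler_peMr ?ler1n.
have [rg|gr] := leP r g.
  apply: le_trans t1' _; rewrite ler_wpM2l//.
  have h1 := Bl r g (lexx _) rg (ltW gd); have h2 := Al g (2 * r) rg (ltW gd) (lexx _).
  have h3 : P / 2 * (2 * r - g) <= g * (A g - A (2 * r)).
    apply: le_trans (ler_wpM2l (ltW g0) h2).
    have -> : g * (P / (2 * r) * (2 * r - g)) = (g / r) * (P / 2 * (2 * r - g)).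
      by field; rewrite gt_eqF.
    rewrite ler_peMl//; last by rewrite ler_pdivlMr// mul1r.
    by rewrite mulr_ge0 ?subr_ge0 ?(ltW gd)// divr_ge0.
  have h4 : P * r <= P * g by rewrite ler_wpM2l.
  have -> : B g + g * (A g - A (2 * r)) - B r = (B g - B r) + g * (A g - A (2 * r)) by ring.
  apply: le_trans (lerD h1 h3).
  have -> : P * (g - r) + P / 2 * (2 * r - g) = P * g / 2 by field.
  by rewrite ler_pM2r ?invr_gt0.
apply: le_trans t2' _; rewrite ler_wpM2l//.
have h2 := Al r (2 * r) (lexx _) r2 (lexx _).
have -> : B g + g * (A g - A (2 * r)) - (B g + g * (A g - A r)) = g * (A r - A (2 * r)) by ring.
apply: le_trans (ler_wpM2l (ltW g0) h2).
rewrite le_eqVlt; apply/orP; left; apply/eqP.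
by field; rewrite gt_eqF.
Qed.

Definition radius (i : nat) : R := eps / 2 ^+ i.

Lemma radiusS i : 2 * radius i.+1 = radius i.
Proof. by rewrite /radius exprS; field; rewrite expf_neq0. Qed.

Hypothesis eps0 : 0 < eps.
Hypothesis B_ge0 : forall x : R, 0 <= B x.

Lemma radius_gt0 i : 0 < radius i.
Proof. by rewrite divr_gt0// exprn_gt0. Qed.

Lemma radius_le i : radius i <= eps.
Proof. by rewrite ler_pdivrMr ?exprn_gt0// ler_peMr ?(ltW eps0)// exprn_ege1// ler1n. Qed.

Lemma dyadic_sum_le N :
  \sum_(0 <= i < N) phi (radius i.+1) / radius i.+1 ^+ k <= 2 ^+ k.+1 * B eps.
Proof.
apply: (@le_trans _ _ (\sum_(0 <= i < N) 2 ^+ k.+1 * (B (radius i) - B (radius i.+1)))).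
  apply: ler_sum => i _; rewrite -(radiusS i); apply: dyadic_term_le; first exact: radius_gt0.
  by rewrite radiusS radius_le.
rewrite -mulr_sumr ler_wpM2l ?exprn_ge0// -[leRHS]opprK -[leLHS]opprK lerN2 -sumrN.
under eq_bigr do rewrite opprB.
rewrite telescope_sumr// {2}/radius expr0 divr1.
by rewrite lerBrDr addNr.
Qed.

Lemma dyadic_truncated_sum_le N (g : R) (t : nat -> R) : 0 < g -> g <= eps ->
  A eps = 0 -> (forall x, 0 < x -> x <= eps -> 0 <= A x) ->
  (forall x y, 0 < x -> x <= y -> y <= eps -> A y <= A x) ->
  (forall i, t i <= phi (radius i.+1) / radius i.+1 ^+ k) ->
  (forall i, t i <= g * (phi (radius i.+1) / radius i.+1 ^+ k.+1)) ->
  \sum_(0 <= i < N) t i <= 2 ^+ k.+2 * (g * A g + B g).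
Proof.
move=> g0 ge A0 Age Am t1 t2; pose W := truncated_weight g.
apply: (@le_trans _ _ (\sum_(0 <= i < N) 2 ^+ k.+2 * (W (radius i) - W (radius i.+1)))).
  apply: ler_sum => i _; rewrite -(radiusS i); apply: dyadic_truncated_term_le => //.
    exact: radius_gt0.
  by rewrite radiusS radius_le.
rewrite -mulr_sumr ler_wpM2l ?exprn_ge0// -[leLHS]opprK -sumrN.
under eq_bigr do rewrite opprB.
rewrite telescope_sumr// {2}/radius expr0 divr1 opprB.
have W0 x : 0 < x -> x <= eps -> 0 <= W x.
  move=> x0 xe; rewrite /W /truncated_weight; have [_|/ltW gx] := leP x g; first exact: B_ge0.
  by rewrite addr_ge0// mulr_ge0 ?(ltW g0)// subr_ge0 Am.
have We : W eps <= g * A g + B g.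
  rewrite /W /truncated_weight A0 subr0; have [eg|_] := leP eps g; last by rewrite addrC.
  have -> : g = eps by apply/eqP; rewrite eq_le ge.
  by rewrite A0 mulr0 add0r.
apply: le_trans We; rewrite gerBl; apply: W0; [exact: radius_gt0|exact: radius_le].
Qed.

End dyadic_sums.

(** Here [a i s] stands for the derivative along [s] of the [i]-th term, [b i] for its size and
    [r i] for its strip width; only real points remain. *)
Lemma Ckw_of_series {R : realType} {n : nat} (k : nat) (eps S Cw : R) (w : R -> R)
    (f : 'rV[R]_n -> R) (a : nat -> seq 'I_n -> 'rV[R]_n -> R) (b r : nat -> R) :
  (forall i, 0 <= b i) -> (forall i, 0 < r i) -> (forall i, r i <= eps) ->
  (forall m, exists2 C, 0 <= C &
     forall i s x, size s = m -> `|a i s x| <= C * b i / r i ^+ m) ->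
  (forall i s j x, is_derive x (unitv j) (a i s) (a i (j :: s) x)) ->
  (forall x, \sum_(0 <= i < N) a i [::] x @[N --> \oo] --> f x) ->
  (forall N, \sum_(0 <= i < N) b i / r i ^+ k <= S) ->
  (forall g, 0 < g -> g <= eps -> forall N (t : nat -> R),
     (forall i, t i <= b i / r i ^+ k) -> (forall i, t i <= g * (b i / r i ^+ k.+1)) ->
     \sum_(0 <= i < N) t i <= Cw * w g) ->
  Ckw k eps w f.
Proof.
move=> b0 r0 re Ha Hd Hf HS Hw.
have eps0 : 0 < eps := lt_le_trans (r0 0%N) (re 0%N).
(* Lower-order derivatives have better bounds; [r i <= eps] brings them to exponent [k] at the cost
   of a power of [eps]. Sums use [l = 0], Lipschitz bounds [l = 1]. *)
have pw m l i : (m <= k)%N -> b i / r i ^+ (m + l) <= eps ^+ (k - m) * (b i / r i ^+ (k + l)).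
  move=> mk; have -> : b i / r i ^+ (m + l) = r i ^+ (k - m) * (b i / r i ^+ (k + l)).
    have -> : (k + l = (k - m) + (m + l))%N by rewrite addnA subnK.
    by rewrite !exprD; field; rewrite !expf_neq0 ?gt_eqF.
  apply: ler_wpM2r; first by rewrite divr_ge0// exprn_ge0// ltW.
  by rewrite lerXn2r// ?nnegrE ltW.
have pw0 m i : (m <= k)%N -> b i / r i ^+ m <= eps ^+ (k - m) * (b i / r i ^+ k).
  by move=> mk; have := pw m 0%N i mk; rewrite !addn0.
have sumC m (C : R) : (m <= k)%N -> 0 <= C ->
    forall N, \sum_(0 <= i < N) C * b i / r i ^+ m <= C * eps ^+ (k - m) * S.
  move=> mk C0 N; apply: (@le_trans _ _ (\sum_(0 <= i < N) C * eps ^+ (k - m) * (b i / r i ^+ k))).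
    by apply: ler_sum => i _; rewrite -!mulrA ler_wpM2l// pw0.
  by rewrite -mulr_sumr ler_wpM2l// mulr_ge0// exprn_ge0// ltW.
have deriv (s : seq 'I_n) (j : 'I_n) (x : 'rV[R]_n) : (size s < k)%N ->
    (forall y, \sum_(0 <= i < N) a i s y @[N --> \oo] --> pdiff s f y) ->
    exists2 l : R, \sum_(0 <= i < N) a i (j :: s) x @[N --> \oo] --> l &
      is_derive x (unitv j) (pdiff s f) l.
  move=> sk cs; have [C C0 HC] := Ha (size s).+1.
  have bnd i y : `|a i (j :: s) y| <= C * b i / r i ^+ (size s).+1 by exact: HC.
  have [l Hl] := bounded_series_cvg (fun i => a i (j :: s) x) _ _ (fun i => bnd i x) (sumC _ _ sk C0).
  exists l => //.
  exact: (is_derive_series (fun i => a i s) (fun i => a i (j :: s)) _ _ _ _ _ _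
            (fun i y => Hd i s j y) bnd (sumC _ _ sk C0) cs Hl).
(* Convergence at one order makes the next derivative exist, which identifies [pdiff] with the sum
   of derivatives step by step. *)
have conv (s : seq 'I_n) : (size s <= k)%N -> forall x : 'rV[R]_n,
    \sum_(0 <= i < N) a i s x @[N --> \oo] --> pdiff s f x.
  elim: s => [|j s IH] sk x; first exact: Hf.
  have [l Hl [_ /= ->]] := deriv s j x sk (IH (ltnW sk)).
  exact: Hl.
split=> [s sk j x|s sk].
  by have [l _ []] := deriv s j x sk (conv s (ltnW sk)).
have [C C0 HC] := Ha (size s); have [C' C'0 HC'] := Ha (size s).+1.
split.
  exists (C * eps ^+ (k - size s) * S) => x; apply: (norm_lim_le _ _ _ 0%N (conv s sk x)) => N _.
  apply: (le_trans (ler_norm_sum _ _ _)); apply: le_trans (sumC _ _ sk C0 N).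
  by apply: ler_sum => i _; exact: HC.
pose E := eps ^+ (k - size s).
have E0 : 0 <= E by rewrite exprn_ge0// ltW.
(* [K] serves both bounds on the increments, [2 * C] from the sup bound and [n%:R * C'] from the
   Lipschitz bound; the [+ 1] allows dividing by it. *)
pose K := (2 * C + n%:R * C') * E + 1.
have K0 : 0 < K by rewrite ltr_wpDl// mulr_ge0// addr_ge0// mulr_ge0.
exists (K * Cw) => x y /andP[xy0 xyd].
have L : \sum_(0 <= i < N) (a i s x - a i s y) @[N --> \oo] --> pdiff s f x - pdiff s f y.
  have -> : (fun N => \sum_(0 <= i < N) (a i s x - a i s y)) =
     (fun N => \sum_(0 <= i < N) a i s x - \sum_(0 <= i < N) a i s y).
    by apply: funext => N; rewrite sumrB.
  by apply: cvgB; exact: conv.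
apply: (norm_lim_le _ _ _ 0%N L) => N _; apply: (le_trans (ler_norm_sum _ _ _)).
have KE (u v : R) : 0 <= v -> u <= (2 * C + n%:R * C') * (E * v) -> u / K <= v.
  move=> v0 uv; rewrite ler_pdivrMr// mulrC (le_trans uv)// mulrA ler_wpM2r//.
  by rewrite lerDl.
have br l i : 0 <= b i / r i ^+ l by rewrite divr_ge0// exprn_ge0// ltW.
have := Hw _ xy0 xyd N (fun i => `|a i s x - a i s y| / K).
rewrite -mulr_suml ler_pdivrMr// => H.
rewrite -mulrA mulrC; apply: H => i; apply: KE => //.
- have h : `|a i s x - a i s y| <= 2 * C * (b i / r i ^+ size s).
    rewrite (le_trans (ler_normB _ _))// -mulrA mulrA -mulrA [2 * _]mulr_natl mulr2n mulrA.
    by rewrite lerD// HC.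
  apply: (le_trans h); apply: ler_pM => //.
  + by rewrite mulr_ge0.
  + by rewrite lerDl mulr_ge0.
  + exact: pw0.
- by rewrite mulr_ge0// ltW.
- have h : `|a i s x - a i s y| <= n%:R * (C' * b i / r i ^+ (size s).+1) * `|x - y|.
    apply: coordinatewise_lipschitz; first by rewrite -mulrA mulr_ge0.
    move=> j z h; apply: (directional_lipschitz (a i s) (a i (j :: s))) => // z'.
    exact: HC'.
  apply: (le_trans h).
  have := pw (size s) 1%N i sk; rewrite !addn1 -/E => h'.
  rewrite -[C' * _ / _]mulrA [leRHS](_ : _ =
    (2 * C + n%:R * C') * (E * (b i / r i ^+ k.+1)) * `|x - y|); last by ring.
  apply: ler_wpM2r; rewrite // mulrA; apply: ler_pM => //.
  + by rewrite mulr_ge0.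
  + by rewrite lerDr mulr_ge0.
Qed.

Lemma weight_modulus {R : realType} (phi : R -> R) (k : nat) (eps : R) :
  0 < eps ->
  (forall x, 0 <= x -> 0 <= phi x) ->
  {in `[0, +oo[ &, {homo phi : x y / x <= y}} ->
  {within `[0, +oo[, continuous phi} ->
  (\int[lebesgue_measure]_(x in `](0 : R)%R, (1 : R)%R]) (wt phi k.+1 x)%:E < +oo)%E ->
  (\int[lebesgue_measure]_(x in `](0 : R)%R, (1 : R)%R]) (wt phi k.+2 x)%:E = +oo)%E ->
  let A x := int_itv (wt phi k.+2) x eps in let B := int0 phi k.+1 in
  modulus eps (wmod A B) /\
  (exists L : R -> R, (\forall g \near 0^'+, 0 < L g) /\ L g @[g --> 0^'+] --> 0 /\
    asym_eq (wmod A B) (fun g => g * A (L g)) /\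
    asym_eq (fun g => g * A (L g)) (fun g => B (L g))) /\
  (forall N, \sum_(0 <= i < N) phi (radius eps i.+1) / radius eps i.+1 ^+ k <= 2 ^+ k.+1 * B eps) /\
  (forall g, 0 < g -> g <= eps -> forall N (t : nat -> R),
     (forall i, t i <= phi (radius eps i.+1) / radius eps i.+1 ^+ k) ->
     (forall i, t i <= g * (phi (radius eps i.+1) / radius eps i.+1 ^+ k.+1)) ->
     \sum_(0 <= i < N) t i <= 2 ^+ k.+2 * wmod A B g).
Proof.
move=> eps0 p0 pm pc Ifin Iinf A B.
have cw m (x : R) : 0 < x -> {within `[x, eps], continuous (wt phi m)}.
  by move=> x0; exact: wt_continuous.
have A_int (x y : R) : 0 < x -> x <= y -> y <= eps -> A x - A y = int_itv (wt phi k.+2) x y.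
  by move=> x0 xy ye; rewrite /A (int_itv_split _ x y eps)// ?addrK//; exact: cw.
have Ii (y : R) := wt_integrable phi p0 pc k.+1 y Ifin.
have B_int (x y : R) : 0 < x -> x <= y -> y <= eps -> B y - B x = int_itv (wt phi k.+1) x y.
  by move=> x0 xy _; exact: int0B.
have A_eps : A eps = 0.
  have h := A_int eps eps eps0 (lexx _) (lexx _).
  by rewrite subrr in h; rewrite /A -h.
have A_mono (x y : R) : 0 < x -> x <= y -> y <= eps -> A y <= A x.
  by move=> x0 xy ye; rewrite -subr_ge0 A_int//; exact: int_wt_ge0.
have B0 (x : R) : 0 <= B x by exact: int0_ge0.
have AB (x y : R) : 0 < x -> x <= y -> y <= eps ->
    x * (A x - A y) <= B y - B x <= y * (A x - A y).
  by move=> x0 xy ye; rewrite A_int// B_int//; exact: int_wtS.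
have AB_le (x y : R) : 0 < x -> x <= y -> y <= eps -> x * (A x - A y) <= B y - B x.
  by move=> x0 xy ye; have /andP[] := AB _ _ x0 xy ye.
have AB_ge (x y : R) : 0 < x -> x <= y -> y <= eps -> B y - B x <= y * (A x - A y).
  by move=> x0 xy ye; have /andP[] := AB _ _ x0 xy ye.
have A_unb (M : R) : exists2 x : R, 0 < x <= eps & M < A x.
  (* Divergence is given on []0, 1]] while [A] integrates up to [eps]; the part between [c] and 1 is
     a fixed amount, absorbed in the threshold. *)
  pose c := Num.min eps 1; have c0 : 0 < c by rewrite lt_min eps0 ltr01.
  have ce : c <= eps by rewrite /c ge_min lexx.
  have c1 : c <= 1 by rewrite /c ge_min lexx orbT.
  have [x /andP[x0 x1] h] := int_wt_unbounded phi p0 pc k.+2 1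
    (`|M| + int_itv (wt phi k.+2) c 1) ltr01 Iinf.
  have xc : x <= c.
    rewrite leNgt; apply/negP => cx; move: h; apply/negP; rewrite -leNgt.
    have cx1 := ltW cx.
    rewrite (int_itv_split _ c x 1)//; last exact: wt_continuous.
    by rewrite addrA lerDr addr_ge0//; exact: int_wt_ge0.
  exists x; first by rewrite x0 (le_trans xc).
  have E : A x = int_itv (wt phi k.+2) x c + A c.
    by rewrite /A (int_itv_split _ x c eps)//; exact: cw.
  have E' : int_itv (wt phi k.+2) x 1 = int_itv (wt phi k.+2) x c + int_itv (wt phi k.+2) c 1.
    by rewrite (int_itv_split _ x c 1)//; exact: wt_continuous.
  have : 0 <= A c by exact: int_wt_ge0.
  have := ler_norm M; move: h; rewrite E' E; move: `|M| (int_itv _ x c) (int_itv _ c 1) (A c) => m u v z; lra.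
have A_lip (x0 : R) : 0 < x0 -> exists2 K : R, 0 <= K &
    forall x y : R, x0 <= x -> x <= y -> y <= eps -> A x - A y <= K * (y - x).
  move=> x00; exists (phi eps / x0 ^+ k.+2).
    by rewrite divr_ge0 ?p0 ?exprn_ge0// ltW.
  move=> x y h1 h2 h3; have x1 : 0 < x := lt_le_trans x00 h1.
  rewrite A_int// -int_itv_cst//; apply: int_itv_le; first exact: wt_continuous.
    exact: within_continuous_cst.
  move=> t /andP[t1 t2].
  have t3 : x0 <= t <= eps by rewrite (le_trans h1 t1) (le_trans t2 h3).
  by have /andP[] := wt_bounds phi p0 pm k.+2 x0 eps t x00 t3.
have B_small (e : R) : 0 < e -> exists2 x : R, 0 < x <= eps & B x <= e.
  by move=> e0; exact: int0_small.
have B_ge x : 0 < x -> x <= eps -> 0 <= B x by [].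
split; first exact: modulus_wmod.
split.
  by apply: (balance_function eps A B).
split=> [N|g g0 ge N t t1 t2]; first exact: dyadic_sum_le.
apply: (dyadic_truncated_sum_le phi k eps A B) => // x x0 xe.
exact: int_wt_ge0.
Qed.

Theorem mainTheorem8 (R : realType) (n : nat) (eps : R) (phi : R -> R)
  (kstar : nat) (F : nat -> 'rV[CC R]_n -> CC R) (f : 'rV[R]_n -> R) :
  (0 < n)%N ->
  0 < eps ->
  (* phi : [0, oo) -> [0, oo) nondecreasing, continuous, phi 0 = 0 *)
  (forall x, 0 <= x -> 0 <= phi x) ->
  {in `[0, +oo[ &, {homo phi : x y / x <= y}} ->
  {within `[0, +oo[, continuous phi} ->
  phi 0 = 0 ->
  (\int[lebesgue_measure]_(x in `](0 : R)%R, (1 : R)%R]) ((phi x / x ^+ kstar.+1)%R)%:E < +oo)%E ->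
  (\int[lebesgue_measure]_(x in `](0 : R)%R, (1 : R)%R]) ((phi x / x ^+ kstar.+2)%R)%:E = +oo)%E ->
  (* r_nu = eps 2^-nu ; f_nu analytic on the strips, real on R^n *)
  (forall nu, analytic_on_strip (eps / 2 ^+ nu) (F nu)) ->
  (forall nu (x : 'rV[R]_n), complex.Im (F nu (cembed x) : R[i]) = 0) ->
  F 0%N = (fun _ => 0) ->
  (forall nu, (0 < nu)%N -> forall z, @strip R n (eps / 2 ^+ nu) z ->
     `|F nu z - F nu.-1 z| <= (((phi (eps / 2 ^+ nu))%:C)%C : CC R)) ->
  (* f is the limit of the f_nu on R^n *)
  (forall x : 'rV[R]_n, F nu (cembed x) @[nu --> \oo] --> (((f x)%:C)%C : CC R)) ->
  exists (delta : R) (w : R -> R) (L : R -> R),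
    modulus delta w /\ Ckw kstar delta w f /\
    (\forall g \near 0^'+, 0 < L g) /\ L g @[g --> 0^'+] --> 0 /\
    asym_eq w (fun g => g * Rintegral lebesgue_measure `[L g, eps]
                          (fun t => phi t / t ^+ kstar.+2)) /\
    asym_eq (fun g => g * Rintegral lebesgue_measure `[L g, eps]
                          (fun t => phi t / t ^+ kstar.+2))
            (fun g => Rintegral lebesgue_measure `]0, L g]
                          (fun t => phi t / t ^+ kstar.+1)).
Proof.
move=> n0 eps0 p0 pm pc phi0 Ifin Iinf HF FIm F0 HFF Hf.
have [Hmod [[L [L1 [L2 [L3 L4]]]] [HS HW]]] :=
  weight_modulus phi kstar eps eps0 p0 pm pc Ifin Iinf.
exists eps, (wmod (fun x => int_itv (wt phi kstar.+2) x eps) (int0 phi kstar.+1)), L.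
split; first exact: Hmod.
(* The claims on [L] are [L1] to [L4] after unfolding [int_itv], [wt] and [int0]. *)
split; last by [].
pose r i := radius eps i.+1.
have r0 i : 0 < r i by exact: radius_gt0.
(* Index [i] of the series is [nu = i + 1]; the increment is used on the narrower of the two strips,
   of radius [r i]. *)
pose G i (z : 'rV[R[i]]_n) : R[i] := F i.+1 z - F i z.
have holF i : sep_hol (radius eps i) (F i) by apply: analytic_on_strip_sep_hol; exact: HF.
have holG i : sep_hol (r i) (G i).
  apply: sep_holB; first exact: holF.
  move=> z zr; apply: holF; apply: ostrip_le zr.
  by rewrite -(radiusS eps i) ler_peMl ?ler1n// ltW.
have bndG i z : ostrip (r i) z -> cabs (G i z) <= phi (r i).
  move=> zr; rewrite cabs_le; apply: HFF => // j; exact: ltW (zr j).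
pose a i s (x : 'rV[R]_n) : R := complex.Re (pds s (G i) (cembed x)).
have pr0 i : 0 <= phi (r i) by apply: p0; exact: ltW.
have strip0 i m (x : 'rV[R]_n) : ostrip (r i / 2 ^+ m) (cembed x).
  by apply: ostrip_cembed; rewrite divr_gt0// exprn_gt0.
apply: (Ckw_of_series kstar eps _ _ _ f a (fun i => phi (r i)) r) => //.
- by move=> i; exact: radius_le.
- move=> m; have [C C0 HC] := cauchy_iterated_partials (R := R) (n := n) m.
  exists C => // i s x sm.
  have [_ h] := HC (r i) (phi (r i)) (G i) s (r0 i) (pr0 i) sm (holG i) (bndG i).
  by apply: le_trans (Re_le_cabs _) _; apply: h; exact: strip0.
- move=> i s j x.
  have [C C0 HC] := cauchy_iterated_partials (R := R) (n := n) (size s).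
  have [h _] := HC (r i) (phi (r i)) (G i) s (r0 i) (pr0 i) erefl (holG i) (bndG i).
  apply: pcdiff_is_derive; apply: pdP h _; exact: strip0.
- move=> x.
  (* The real parts telescope to that of [F N], because [F 0] vanishes. *)
  have -> : (fun N => \sum_(0 <= i < N) a i [::] x) =
      (fun N => complex.Re (F N (cembed x) : R[i])).
    apply: funext => N; rewrite /a /G /=.
    under eq_bigr do rewrite raddfB.
    by rewrite telescope_sumr// F0 /= subr0.
  apply/cvgrPdist_le => e e0.
  have re0 : 0 < rc e by rewrite -[0]/(rc 0) rc_lt.
  have [N _ HN] := (cvgrPdist_le _ _).1 (Hf x) (rc e) re0.
  exists N => // M NM; have := HN M NM; rewrite /= -cabs_le.
  by apply: le_trans; apply: le_trans (Re_le_cabs _); case: (F M _) => ? ?.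
- exact: HW.
Qed.
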